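(* Suppose Assumption 1 and Assumption 2 (both stated in the context) hold. Then the coupled set of algebraic Riccati equations $$(X_1,K_1)=ARE_p(A,B,F,H),$$ $$(X_i,K_i)=ARE_p\big(A+L_{i-1}C_{\uparrow i-1},\,B^{\downarrow i},\,-H^{\downarrow i-1}K_{i-1},\,H^{\downarrow i}\big),\quad i\in\{2,\dots,N\},$$ $$(Y_N,L_N)=ARE_d(A,C,W,V),$$ $$(Y_i,L_i)=ARE_d\big(A+B^{\downarrow i+1}K_{i+1},\,C_{\uparrow i},\,-L_{i+1}V_{\uparrow i+1},\,V_{\uparrow i}\big),\quad i\in\{1,\dots,N-1\},$$ admits a unique tuple of positive semidefinite solutions $X_i,Y_i$, $i\in\{1,\dots,N\}$. Moreover, these are stabilizing solutions of the respective equations.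
   Context: **Data and partition.** $N\ge 1$; $n=n_1+\dots+n_N$, $m=m_1+\dots+m_N$, $p=p_1+\dots+p_N$. $A\in\mathbb R^{n\times n}$, $B\in\mathbb R^{n\times m}$, $C\in\mathbb R^{p\times n}$ are partitioned into $N\times N$ blocks accordingly ($A_{ii},B_{ii},C_{ii}$ denote diagonal blocks) and are lower block triangular. $F\in\mathbb R^{q\times n}$, $H\in\mathbb R^{q\times m}$, $W\in\mathbb R^{n\times r}$, $V\in\mathbb R^{p\times r}$ are real matrices. $\Psi=H^TH$, $\Phi=VV^T$. **Block notation.** For an identity matrix partitioned into $N$ blocks (of size $n$, $m$ or $p$, as dimensions dictate), $E^{\uparrow i}$ / $E_{\uparrow i}$ consists of block columns / rows $1,\dots,i$; $E^{\downarrow i}$ / $E_{\downarrow i}$ consists of block columns / rows $i,\dots,N$. For a matrix $M$: $M^{\uparrow i}=ME^{\uparrow i}$, $M^{\downarrow i}=ME^{\downarrow i}$, $M_{\uparrow i}=E_{\uparrow i}M$, $M_{\downarrow i}=E_{\downarrow i}M$, $M_{\downarrow i}^{\uparrow j}=E_{\downarrow i}ME^{\uparrow j}$, and similarly for other combinations. $\mathrm{row}\{M_1,\dots,M_k\}=[M_1\ \cdots\ M_k]$; $\mathrm{col}\{M_1,\dots,M_k\}$ is vertical stacking. **Riccati notation.** $(X,K)=ARE_p(A,B,F,H)$ means that $X$ (symmetric) satisfies $A^TX+XA-(XB+F^TH)(H^TH)^{-1}(XB+F^TH)^T+F^TF=0$ and $K=-(H^TH)^{-1}(XB+F^TH)^T$;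 it is stabilizing if $A+BK$ is Hurwitz. $(Y,L)=ARE_d(A,C,W,V)$ means that $Y$ (symmetric) satisfies $AY+YA^T-(CY+VW^T)^T(VV^T)^{-1}(CY+VW^T)+WW^T=0$ and $L=-(CY+VW^T)^T(VV^T)^{-1}$; it is stabilizing if $A+LC$ is Hurwitz. (The letters here are formal arguments.) **Assumption 1.** (1) Each $(A_{ii},B_{ii})$ is stabilizable and $H$ has full column rank. (2) $\begin{bmatrix} A-j\omega I & B \\ F & H \end{bmatrix}$ has full column rank for all $\omega\in\mathbb R$. (3) Each $(C_{ii},A_{ii})$ is detectable and $V$ has full row rank. (4) $\begin{bmatrix} A-j\omega I & W \\ C & V \end{bmatrix}$ has full row rank for all $\omega\in\mathbb R$. **Hatted quantities.** Under Assumption 1 the following are well defined as the unique positive semidefinite (and stabilizing) solutions, computed recursively: $(\hat X_1,\hat K_1)=ARE_p(A,B,F,H)$ and, for $i=2,\dots,N$, $(\hat X_i,\hat K_i)=ARE_p(A_{\downarrow i}^{\downarrow i},B_{\downarrow i}^{\downarrow i},-H^{\downarrow i-1}\hat K_{i-1}^b,H^{\downarrow i})$; $(\hat Y_N,\hat L_N)=ARE_d(A,C,W,V)$ and, for $i=N-1,\dots,1$, $(\hat Y_i,\hat L_i)=ARE_d(A_{\uparrow i}^{\uparrow i},C_{\uparrow i}^{\uparrow i},-\hat L_{i+1}^bV_{\uparrow i+1},V_{\uparrow i})$. Here $\hat K_i=\mathrm{row}\{\hat K_i^a,\hat K_i^b\}$ with $\hat K_i^a$ the first $n_i$ columns, and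 $\hat L_i=\mathrm{col}\{\hat L_i^b,\hat L_i^a\}$ with $\hat L_i^a$ the last $n_i$ rows. **Assumption 2.** The following linear system in the unknowns $\bar X_i\in\mathbb R^{(n_1+\dots+n_{i-1})\times(n_i+\dots+n_N)}$, $\bar K_i\in\mathbb R^{(m_i+\dots+m_N)\times(n_1+\dots+n_{i-1})}$ ($i=2,\dots,N$) and $\bar Y_i\in\mathbb R^{(n_1+\dots+n_i)\times(n_{i+1}+\dots+n_N)}$, $\bar L_i\in\mathbb R^{(n_{i+1}+\dots+n_N)\times(p_1+\dots+p_i)}$ ($i=1,\dots,N-1$) has a unique solution ($\bar K_1$, $\bar L_N$ are empty). For $i=2,\dots,N$: $$\bar K_i^T\Psi_{\downarrow i}^{\downarrow i}+\bar X_iB_{\downarrow i}^{\downarrow i}-\mathrm{row}\{\bar K_{i-1},\hat K_{i-1}^a\}^T\Psi_{\downarrow i-1}^{\downarrow i}=0,$$ $$(\hat A_{i-1}^L)^T\bar X_i+\bar X_i\hat A_i^K+(\bar A_{i-1}^L)^T\hat X_i+\mathrm{row}\{\bar K_{i-1},\hat K_{i-1}^a\}^T(\Psi_{\downarrow i-1}^{\downarrow i-1}\hat K_{i-1}^b-\Psi_{\downarrow i-1}^{\downarrow i}\hat K_i)=0;$$ for $i=1,\dots,N-1$: $$\Phi_{\uparrow i}^{\uparrow i}\bar L_i^T+C_{\uparrow i}^{\uparrow i}\bar Y_i-\Phi_{\uparrow i}^{\uparrow i+1}\mathrm{col}\{\hat L_{i+1}^a,\bar L_{i+1}\}^T=0,$$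 $$\hat A_i^L\bar Y_i+\bar Y_i(\hat A_{i+1}^K)^T+\hat Y_i(\bar A_{i+1}^K)^T+(\hat L_{i+1}^b\Phi_{\uparrow i+1}^{\uparrow i+1}-\hat L_i\Phi_{\uparrow i}^{\uparrow i+1})\mathrm{col}\{\hat L_{i+1}^a,\bar L_{i+1}\}^T=0,$$ where $\hat A_i^K=A_{\downarrow i}^{\downarrow i}+B_{\downarrow i}^{\downarrow i}\hat K_i$, $\bar A_i^K=A_{\downarrow i}^{\uparrow i-1}+B_{\downarrow i}^{\downarrow i}\bar K_i$, $\hat A_i^L=A_{\uparrow i}^{\uparrow i}+\hat L_iC_{\uparrow i}^{\uparrow i}$, $\bar A_i^L=A_{\downarrow i+1}^{\uparrow i}+\bar L_iC_{\uparrow i}^{\uparrow i}$.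
   Formalization: Uniqueness is asserted among positive semidefinite tuples whose X_1 and Y_N solutions are stabilizing, and the hatted solutions are taken to be the stabilizing ones: without this it fails, e.g. N=1, A=B=C=H=V=1, F=W=0, where X=0 and X=2 both solve the equation. *)

(* Defs.v *)
From mathcomp Require Import all_boot all_order all_algebra.
From mathcomp Require Import reals complex.

Set Implicit Arguments.
Unset Strict Implicit.
Unset Printing Implicit Defensive.

Import Order.TTheory GRing.Theory Num.Theory.
Local Open Scope ring_scope.
Local Open Scope complex_scope.

Definition cplx (R : realType) a b (M : 'M[R]_(a, b)) : 'M[R[i]]_(a, b) :=
  map_mx (real_complex R) M.

Definition hurwitz (R : realType) a (M : 'M[R]_a) : Prop :=
  forall z : R[i], eigenvalue (cplx M) z -> complex.Re z < 0.

Definition stabilizable (R : realType) a b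
    (A : 'M[R]_a) (B : 'M[R]_(a, b)) : Prop :=
  exists K : 'M[R]_(b, a), hurwitz (A + B *m K).

Definition detectable (R : realType) a b
    (C : 'M[R]_(b, a)) (A : 'M[R]_a) : Prop :=
  exists L : 'M[R]_(a, b), hurwitz (A + L *m C).

Definition psd (R : realType) a (X : 'M[R]_a) : Prop :=
  X^T = X /\ forall v : 'cV[R]_a, 0 <= (v^T *m X *m v) 0 0.

(* [AREp A B F H X K] is (X, K) = ARE_p(A, B, F, H), and [AREd A C W V Y L] is
   (Y, L) = ARE_d(A, C, W, V). *)
Definition AREp (R : realType) a b c (A : 'M[R]_a) (B : 'M[R]_(a, b))
    (F : 'M[R]_(c, a)) (H : 'M[R]_(c, b))
    (X : 'M[R]_a) (K : 'M[R]_(b, a)) : Prop :=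
  [/\ X^T = X,
      A^T *m X + X *m A
        - (X *m B + F^T *m H) *m invmx (H^T *m H) *m (X *m B + F^T *m H)^T
        + F^T *m F = 0
    & K = - (invmx (H^T *m H) *m (X *m B + F^T *m H)^T)].

Definition AREd (R : realType) a b c (A : 'M[R]_a) (C : 'M[R]_(b, a))
    (W : 'M[R]_(a, c)) (V : 'M[R]_(b, c))
    (Y : 'M[R]_a) (L : 'M[R]_(a, b)) : Prop :=
  [/\ Y^T = Y,
      A *m Y + Y *m A^T
        - (C *m Y + V *m W^T)^T *m invmx (V *m V^T) *m (C *m Y + V *m W^T)
        + W *m W^T = 0
    & L = - ((C *m Y + V *m W^T)^T *m invmx (V *m V^T))].

(* Block sizes are s 1, ..., s N (other values of s are irrelevant).  The total
   size is [upsz s N], which is convertible to [dnsz N s 1]. *)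
Definition upsz (s : nat -> nat) (i : nat) : nat :=
  (\sum_(1 <= j < i.+1) s j)%N.
Definition dnsz (N : nat) (s : nat -> nat) (i : nat) : nat :=
  (\sum_(i <= j < N.+1) s j)%N.

(* Columns off, ..., off + b - 1 (counted from 0) of the identity of size a. *)
Definition idcols (R : realType) (off a b : nat) : 'M[R]_(a, b) :=
  \matrix_(k, l) (k == off + l :> nat)%N%:R.

(* row{M1, M2} and col{M1, M2} at the target type.  The widths (heights) b1 + b2
   and b agree in every use below, but not always by conversion; conform_mx is
   then the cast along that equality. *)
Definition rowcat (R : realType) a b1 b2 b
    (M1 : 'M[R]_(a, b1)) (M2 : 'M[R]_(a, b2)) : 'M[R]_(a, b) :=
  conform_mx 0 (row_mx M1 M2).
Definition colcat (R : realType) a b1 b2 b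
    (M1 : 'M[R]_(b1, a)) (M2 : 'M[R]_(b2, a)) : 'M[R]_(b, a) :=
  conform_mx 0 (col_mx M1 M2).

Section Blocks.

Variables (R : realType) (N : nat).

(* E^{up i}, E^{down i} (for 1 <= i), and block column i of the identity. *)
Definition Eup (s : nat -> nat) i : 'M[R]_(upsz s N, upsz s i) :=
  idcols R 0 _ _.
Definition Edn (s : nat -> nat) i : 'M[R]_(upsz s N, dnsz N s i) :=
  idcols R (upsz s i.-1) _ _.
Definition Eblk (s : nat -> nat) i : 'M[R]_(upsz s N, s i) :=
  idcols R (upsz s i.-1) _ _.

(* Columns (c) and rows (r) of M in the block ranges up i and down i. *)
Definition cup s a (M : 'M[R]_(a, upsz s N)) i := M *m Eup s i.
Definition cdn s a (M : 'M[R]_(a, upsz s N)) i := M *m Edn s i.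
Definition rup s a (M : 'M[R]_(upsz s N, a)) i := (Eup s i)^T *m M.
Definition rdn s a (M : 'M[R]_(upsz s N, a)) i := (Edn s i)^T *m M.

Definition block s t (M : 'M[R]_(upsz s N, upsz t N)) i j : 'M[R]_(s i, t j) :=
  (Eblk s i)^T *m M *m Eblk t j.

Definition lower_block_triangular s t (M : 'M[R]_(upsz s N, upsz t N)) : Prop :=
  forall i j, (1 <= i)%N -> (i < j)%N -> (j <= N)%N -> block M i j = 0.

End Blocks.

Section Problem.

Variables (R : realType) (N : nat) (n m p : nat -> nat) (q r : nat).

Notation up := upsz.
Notation dn := (dnsz N).

Variables (A : 'M[R]_(up n N, up n N)) (B : 'M[R]_(up n N, up m N))
  (C : 'M[R]_(up p N, up n N)) (F : 'M[R]_(q, up n N)) (H : 'M[R]_(q, up m N))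
  (W : 'M[R]_(up n N, r)) (V : 'M[R]_(up p N, r)).

(* row_full: the rank is the number of columns; row_free: the rank is the
   number of rows. *)
Definition assumption1 : Prop :=
  [/\ (forall i, (1 <= i <= N)%N -> stabilizable (block A i i) (block B i i))
        /\ row_full H,
      forall w : R,
        row_full (block_mx (cplx A - (0 +i* w)%:M) (cplx B) (cplx F) (cplx H)),
      (forall i, (1 <= i <= N)%N -> detectable (block C i i) (block A i i))
        /\ row_free V
    & forall w : R,
        row_free (block_mx (cplx A - (0 +i* w)%:M) (cplx W) (cplx C) (cplx V))].

Definition Psi : 'M[R]_(up m N) := H^T *m H.
Definition Phi : 'M[R]_(up p N) := V *m V^T.

Section Hatted.

Variables (Xh : forall i, 'M[R]_(dn n i)) (Kh : forall i, 'M[R]_(dn m i, dn n i))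
  (Yh : forall i, 'M[R]_(up n i)) (Lh : forall i, 'M[R]_(up n i, up p i)).

Definition Kha i : 'M[R]_(dn m i, n i) := Kh i *m idcols R 0 _ _.
Definition Khb i : 'M[R]_(dn m i, dn n i.+1) := Kh i *m idcols R (n i) _ _.
Definition Lhb i : 'M[R]_(up n i.-1, up p i) := (idcols R 0 _ _)^T *m Lh i.
Definition Lha i : 'M[R]_(n i, up p i) := (idcols R (up n i.-1) _ _)^T *m Lh i.

Definition AhK i : 'M[R]_(dn n i) := rdn (cdn A i) i + rdn (cdn B i) i *m Kh i.
Definition AhL i : 'M[R]_(up n i) := rup (cup A i) i + Lh i *m rup (cup C i) i.

(* The stabilizing positive semidefinite solutions.  Without the stabilizing
   requirement the equations for Xh 1 and Yh N can have several positive
   semidefinite solutions: for A = B = H = 1 and F = 0 (scalars), both X = 0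
   and X = 2 solve ARE_p(A, B, F, H). *)
Definition hatted : Prop :=
  [/\ AREp A B F H (Xh 1%N) (Kh 1%N)
        /\ (forall i, (1 <= i < N)%N ->
              AREp (rdn (cdn A i.+1) i.+1) (rdn (cdn B i.+1) i.+1)
                (- (cdn H i *m Khb i)) (cdn H i.+1) (Xh i.+1) (Kh i.+1)),
      AREd A C W V (Yh N) (Lh N)
        /\ (forall i, (1 <= i < N)%N ->
              AREd (rup (cup A i) i) (rup (cup C i) i)
                (- (Lhb i.+1 *m rup V i.+1)) (rup V i) (Yh i) (Lh i)),
      forall i, (1 <= i <= N)%N -> psd (Xh i) /\ psd (Yh i)
    & forall i, (1 <= i <= N)%N -> hurwitz (AhK i) /\ hurwitz (AhL i)].

Section LinearSystem.

(* Xb and Kb are used for indices 2, ..., N and Yb and Lb for 1, ..., N-1;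
   Kb 1 and Lb N are empty matrices. *)
Variables (Xb : forall i, 'M[R]_(up n i.-1, dn n i))
  (Kb : forall i, 'M[R]_(dn m i, up n i.-1))
  (Yb : forall i, 'M[R]_(up n i, dn n i.+1))
  (Lb : forall i, 'M[R]_(dn n i.+1, up p i)).

Definition AbK i : 'M[R]_(dn n i, up n i.-1) :=
  rdn (cup A i.-1) i + rdn (cdn B i) i *m Kb i.
Definition AbL i : 'M[R]_(dn n i.+1, up n i) :=
  rdn (cup A i) i.+1 + Lb i *m rup (cup C i) i.

Definition rowK i : 'M[R]_(dn m i, up n i) := rowcat _ (Kb i) (Kha i).
Definition colL i : 'M[R]_(dn n i, up p i) := colcat _ (Lha i) (Lb i).

(* In the first two equations i is the index i - 1 of the usual presentation. *)
Definition linear_system : Prop :=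
  forall i, (1 <= i < N)%N ->
  [/\ (Kb i.+1)^T *m rdn (cdn Psi i.+1) i.+1
        + Xb i.+1 *m rdn (cdn B i.+1) i.+1
        - (rowK i)^T *m rdn (cdn Psi i.+1) i = 0,
      (AhL i)^T *m Xb i.+1 + Xb i.+1 *m AhK i.+1 + (AbL i)^T *m Xh i.+1
        + (rowK i)^T *m (rdn (cdn Psi i) i *m Khb i
                         - rdn (cdn Psi i.+1) i *m Kh i.+1) = 0,
      rup (cup Phi i) i *m (Lb i)^T + rup (cup C i) i *m Yb i
        - rup (cup Phi i.+1) i *m (colL i.+1)^T = 0
    & AhL i *m Yb i + Yb i *m (AhK i.+1)^T + Yh i *m (AbK i.+1)^T
        + (Lhb i.+1 *m rup (cup Phi i.+1) i.+1
           - Lh i *m rup (cup Phi i.+1) i) *m (colL i.+1)^T = 0].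

End LinearSystem.

Definition linear_system_uniquely_solvable : Prop :=
  exists Xb Kb Yb Lb,
    linear_system Xb Kb Yb Lb /\
    forall Xb' Kb' Yb' Lb', linear_system Xb' Kb' Yb' Lb' ->
      (forall i, (2 <= i <= N)%N -> Xb' i = Xb i /\ Kb' i = Kb i) /\
      (forall i, (1 <= i < N)%N -> Yb' i = Yb i /\ Lb' i = Lb i).

End Hatted.

(* Under assumption1, hatted determines Xh, Kh, Yh, Lh uniquely on 1, ..., N. *)
Definition assumption2 : Prop :=
  forall Xh Kh Yh Lh, hatted Xh Kh Yh Lh ->
    linear_system_uniquely_solvable Xh Kh Yh Lh.

Section Coupled.

Variables (X : nat -> 'M[R]_(up n N)) (K : forall i, 'M[R]_(dn m i, up n N))
  (Y : nat -> 'M[R]_(up n N)) (L : forall i, 'M[R]_(up n N, up p i)).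

Definition coupled_AREs : Prop :=
  [/\ AREp A B F H (X 1%N) (K 1%N),
      forall i, (2 <= i <= N)%N ->
        AREp (A + L i.-1 *m rup C i.-1) (cdn B i)
          (- (cdn H i.-1 *m K i.-1)) (cdn H i) (X i) (K i),
      AREd A C W V (Y N) (L N)
    & forall i, (1 <= i < N)%N ->
        AREd (A + cdn B i.+1 *m K i.+1) (rup C i)
          (- (L i.+1 *m rup V i.+1)) (rup V i) (Y i) (L i)].

Definition coupled_psd : Prop :=
  forall i, (1 <= i <= N)%N -> psd (X i) /\ psd (Y i).

(* The two equations that involve no other unknown are stabilizing.  Positive
   semidefiniteness does not imply this under assumption1 (see [hatted]); given
   it, positive semidefinite solutions of the other equations are stabilizing,
   so uniqueness is asserted among the positive semidefinite tuples satisfying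
   just this. *)
Definition stabilizing_ends : Prop :=
  hurwitz (A + B *m K 1%N) /\ hurwitz (A + L N *m C).

Definition coupled_stabilizing : Prop :=
  [/\ stabilizing_ends,
      forall i, (2 <= i <= N)%N ->
        hurwitz (A + L i.-1 *m rup C i.-1 + cdn B i *m K i)
    & forall i, (1 <= i < N)%N ->
        hurwitz (A + cdn B i.+1 *m K i.+1 + L i *m rup C i)].

End Coupled.

End Problem.

(* Main.v *)
Require Import Defs.
From mathcomp Require Import all_boot all_order all_algebra.
From mathcomp Require Import reals complex ring lra zify.

(** A coupled equation is a Riccati equation for block triangular data.  Split at
    the boundary between blocks [i] and [i + 1], the lower right block of
    [X_(i+1)] solves the decoupled equation of [Xhat_(i+1)], the off-diagonal
    block solves the linear system of Assumption 2, and the remaining block then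
    solves a Lyapunov equation; [Y_i] is treated in the same way after
    transposition.  Both equations have the same closed loop matrix
    [A + B^(down i+1) K_(i+1) + L_i C_(up i)], which is block triangular with
    diagonal blocks [AhatL_i] and [AhatK_(i+1)], hence Hurwitz.

    The decoupled solutions exist by the Hamiltonian method: feedback-stabilized
    data have no invariant zero in the closed right half plane, and this is
    inherited by the trailing blocks.  For the same reason a positive
    semidefinite solution of a later equation is stabilizing, hence unique. *)

Set Implicit Arguments.
Unset Strict Implicit.
Unset Printing Implicit Defensive.

Import Order.TTheory GRing.Theory Num.Theory.
Local Open Scope ring_scope.

(** * Stable matrices, Sylvester and Lyapunov equations *)

(** Cutting at a boundary separates the unknowns because [cdn B i.+1] has rows in the trailing
    blocks only and [rup C i] has columns in the leading blocks only: the leading diagonal block of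
    [X i.+1] and the trailing one of [Y i] enter no gain. Hence the hatted gains form two
    independent recursions, upward for [K] and downward for [L], and the two families meet only in
    the off-diagonal blocks; this linear coupling is what Assumption 2 resolves. The rank conditions
    of Assumption 1 exclude zeros on the imaginary axis only, which does not make positive
    semidefinite solutions stabilizing at the two ends. Every later equation carries the output
    [- H K] of a stabilizing gain with [H] of full column rank: zero output forces the input [K x],
    so an invariant zero would be a closed-loop eigenvalue. One algebraic fact, that a homogeneous
    Sylvester equation with two stable coefficients has only the trivial solution, yields isotropy
    of stable subspaces, uniqueness of stabilizing solutions and solvability of Lyapunov equations;
    no matrix exponential occurs. *)

Lemma addmxE (V : zmodType) m n (M P : 'M[V]_(m, n)) i j :
  (M + P) i j = M i j + P i j.
Proof. by rewrite mxE. Qed.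

Lemma oppmxE (V : zmodType) m n (M : 'M[V]_(m, n)) i j : (- M) i j = - M i j.
Proof. by rewrite mxE. Qed.

Lemma zeromxE (V : zmodType) m n i j : (0 : 'M[V]_(m, n)) i j = 0.
Proof. by rewrite mxE. Qed.

Lemma scalemxE (A : pzRingType) m n a (M : 'M[A]_(m, n)) i j :
  (a *: M) i j = a * M i j.
Proof. by rewrite mxE. Qed.

(** For identities that are linear in matrix products: entrywise, every product is an atom for
    [ring], so products must be distributed and reassociated beforehand. *)
Ltac mxabel :=
  apply/matrixP => ? ?;
  rewrite ?(addmxE, oppmxE, zeromxE, scalemxE); ring.

Lemma trmxN (V : zmodType) m n (M : 'M[V]_(m, n)) : (- M)^T = - M^T.
Proof. by apply/matrixP => i j; rewrite !mxE. Qed.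

Lemma trmxD (V : zmodType) m n (M P : 'M[V]_(m, n)) : (M + P)^T = M^T + P^T.
Proof. by apply/matrixP => i j; rewrite !mxE. Qed.

Section Spectrum.
Variable C : numClosedFieldType.

(* Twice the real part of z is z + z^*, which needs no projection to a real field. *)
Definition stable k (M : 'M[C]_k) := forall z, eigenvalue M z -> z + z^* < 0.

(** Hermitian adjoint, not the adjugate. *)
Definition adj m n (M : 'M[C]_(m, n)) : 'M[C]_(n, m) := map_mx Num.conj M^T.

Lemma adjM m n k (M : 'M_(m, n)) (P : 'M_(n, k)) : adj (M *m P) = adj P *m adj M.
Proof. by rewrite /adj trmx_mul map_mxM. Qed.

Lemma adjD m n (M P : 'M_(m, n)) : adj (M + P) = adj M + adj P.
Proof. by rewrite /adj linearD map_mxD. Qed.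

Lemma adjN m n (M : 'M_(m, n)) : adj (- M) = - adj M.
Proof. by rewrite /adj linearN map_mxN. Qed.

Lemma adjK m n (M : 'M_(m, n)) : adj (adj M) = M.
Proof. by apply/matrixP => i j; rewrite !mxE conjCK. Qed.

Lemma adj0 m n : adj (0 : 'M_(m, n)) = 0.
Proof. by rewrite /adj trmx0 map_mx0. Qed.

Lemma adjZ m n z (M : 'M_(m, n)) : adj (z *: M) = z^* *: adj M.
Proof. by apply/matrixP => i j; rewrite !mxE rmorphM. Qed.

Lemma adj_tr m n (M : 'M_(m, n)) : (adj M)^T = adj M^T.
Proof. by apply/matrixP => i j; rewrite !mxE. Qed.

Lemma addCJ_real (z : C) : z + z^* \is Num.real.
Proof. by apply/CrealP; rewrite rmorphD /= conjCK addrC. Qed.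

Lemma addCJ_ge0 (z : C) : (0 <= z + z^*) = ~~ (z + z^* < 0).
Proof. by rewrite real_leNgt ?rpred0 ?addCJ_real. Qed.

Lemma char_poly_tr (F : comNzRingType) k (M : 'M[F]_k) :
  char_poly M^T = char_poly M.
Proof.
rewrite /char_poly -det_tr; congr (\det _); apply/matrixP => i j.
by rewrite !mxE eq_sym.
Qed.

Lemma stable_tr k (M : 'M[C]_k) : stable M -> stable M^T.
Proof.
by move=> h z; rewrite eigenvalue_root_char char_poly_tr -eigenvalue_root_char => /h.
Qed.

Lemma stable_adj k (M : 'M[C]_k) : stable M -> stable (adj M).
Proof.
move=> /stable_tr h z; rewrite /adj -[z in eigenvalue _ z]conjCK eigenvalue_map => /h.
by rewrite conjCK addrC.
Qed.

Lemma stable_row j k (M : 'M[C]_k) (v : 'M[C]_(j, k)) z :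
  stable M -> v *m M = z *: v -> 0 <= z + z^* -> v = 0.
Proof.
move=> hM e; rewrite addCJ_ge0 => hz; apply/eqP; rewrite -submx0.
suff /eqP <- : eigenspace M z == 0 by apply/eigenspaceP.
by apply: contraNT hz => /hM.
Qed.

Lemma stable_col j k (M : 'M[C]_k) (v : 'M[C]_(k, j)) z :
  stable M -> M *m v = z *: v -> 0 <= z + z^* -> v = 0.
Proof.
move=> hM e hz; apply: trmx_inj; rewrite trmx0.
by apply: (stable_row (stable_tr hM) _ hz); rewrite -trmx_mul e linearZ.
Qed.

Lemma stable_colP k (M : 'M[C]_k) :
  (forall z (x : 'cV_k), M *m x = z *: x -> 0 <= z + z^* -> x = 0) -> stable M.
Proof.
move=> h z; rewrite eigenvalue_root_char -char_poly_tr -eigenvalue_root_char.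
case/eigenvalueP => v ev nzv; apply: contraT; rewrite -addCJ_ge0 => hz.
case/eqP: nzv; apply: trmx_inj; rewrite trmx0.
by apply: h hz; rewrite -[M]trmxK -trmx_mul ev linearZ.
Qed.

Lemma horner_mx_intertwine (F : comNzRingType) m n (M : 'M[F]_m.+1) (P : 'M[F]_n.+1)
    (X : 'M_(m.+1, n.+1)) (f : {poly F}) :
  M *m X = X *m P -> horner_mx M f *m X = X *m horner_mx P f.
Proof.
move=> e; elim/poly_ind: f => [|f c ih]; first by rewrite !rmorph0 mul0mx mulmx0.
rewrite !rmorphD !rmorphM /= !horner_mx_X !horner_mx_C mulmxDl mulmxDr.
by rewrite -mulmxA e mulmxA ih -mulmxA mul_scalar_mx mul_mx_scalar.
Qed.

(** Rows killed by [M - z] lie in the eigenspace at [z], which is zero, so the linear factors cancel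
    one by one. *)
Lemma mul_horner_prod_eq0 j k (M : 'M[C]_k.+1) (X : 'M_(j, k.+1)) (zs : seq C) :
  {in zs, forall z, ~~ eigenvalue M z} ->
  X *m horner_mx M (\prod_(z <- zs) ('X - z%:P)) = 0 -> X = 0.
Proof.
elim: zs X => [|z zs ih] X h; first by rewrite big_nil rmorph1 mulmx1.
rewrite big_cons rmorphM /= mulmxA => e.
have: X *m horner_mx M ('X - z%:P) = 0.
  by apply: ih e => y hy; apply: h; rewrite inE hy orbT.
rewrite rmorphB /= horner_mx_X horner_mx_C.
rewrite mulmxBr mul_mx_scalar => /eqP; rewrite subr_eq0 => /eqP /eigenspaceP.
have := h z (mem_head _ _); rewrite negbK => /eqP ->.
by rewrite submx0 => /eqP.
Qed.

(** The relation [M X = X (- P)] passes to polynomials. The characteristic polynomial of [M]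
    annihilates [M], while its roots, lying in the open left half plane, are no eigenvalues of
    [- P]. *)
Lemma sylvester_injC m n (M : 'M[C]_m) (P : 'M[C]_n) X :
  stable M -> stable P -> M *m X + X *m P = 0 -> X = 0.
Proof.
case: m n => [|m] [|n] in M P X *; rewrite ?(flatmx0 X) ?(thinmx0 X) //.
move=> hM hP /eqP; rewrite addr_eq0 -mulmxN => /eqP /horner_mx_intertwine e.
have := e (char_poly M); rewrite Cayley_Hamilton mul0mx => /esym.
have [zs ezs] := closed_field_poly_normal (char_poly M).
rewrite ezs (monicP (char_poly_monic M)) scale1r; apply: mul_horner_prod_eq0 => z hz.
have /hM hz0 : eigenvalue M z.
  rewrite eigenvalue_root_char ezs (monicP (char_poly_monic M)) scale1r.
  by rewrite root_prod_XsubC.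
apply/negP => /eigenvalueP [v ev nzv]; case/eqP: nzv.
apply: (@stable_row _ _ P v (- z)) => //.
  by rewrite -[LHS]opprK -mulmxN ev scaleNr.
by rewrite rmorphN /= -opprD oppr_ge0 ltW.
Qed.

End Spectrum.

Section Cplx.
Local Open Scope complex_scope.
Variable R : realType.
Local Notation C := R[i].

Lemma conjC_real (x : R) : Num.conj x%:C = x%:C.
Proof. by apply/CrealP; apply/complex_realP; exists x. Qed.

Lemma adj_cplx m n (M : 'M[R]_(m, n)) : adj (cplx M) = (cplx M)^T.
Proof. by apply/matrixP => i j; rewrite !mxE conjC_real. Qed.

Lemma cplx_inj m n : injective (@cplx R m n).
Proof.
move=> M P /matrixP e; apply/matrixP => i j.
by have := e i j; rewrite !mxE => /complexI.
Qed.

Lemma cplxM m n k (M : 'M[R]_(m, n)) (P : 'M[R]_(n, k)) :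
  cplx (M *m P) = cplx M *m cplx P.
Proof. exact: map_mxM. Qed.

Lemma cplxD m n (M P : 'M[R]_(m, n)) : cplx (M + P) = cplx M + cplx P.
Proof. exact: map_mxD. Qed.

Lemma cplxN m n (M : 'M[R]_(m, n)) : cplx (- M) = - cplx M.
Proof. exact: map_mxN. Qed.

Lemma cplx0 m n : cplx (0 : 'M[R]_(m, n)) = 0.
Proof. exact: map_mx0. Qed.

Lemma cplx_tr m n (M : 'M[R]_(m, n)) : cplx M^T = (cplx M)^T.
Proof. exact/esym/map_trmx. Qed.

Lemma addCJ_lt0E (z : C) : (z + Num.conj z < 0) = (complex.Re z < 0).
Proof.
case: z => x y; rewrite ltcE /= addrN eqxx /=.
by apply/idP/idP; lra.
Qed.

Lemma addCJ_ge0E (z : C) : (0 <= z + Num.conj z) = (0 <= complex.Re z).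
Proof. by rewrite addCJ_ge0 addCJ_lt0E -leNgt. Qed.

Lemma hurwitz_stable k (M : 'M[R]_k) : hurwitz M <-> stable (cplx M).
Proof. by split=> h z /h; rewrite addCJ_lt0E. Qed.

Lemma hurwitz_tr k (M : 'M[R]_k) : hurwitz M -> hurwitz M^T.
Proof. by rewrite !hurwitz_stable cplx_tr; apply: stable_tr. Qed.

Lemma sylvester_inj m n (M : 'M[R]_m) (P : 'M[R]_n) X :
  hurwitz M -> hurwitz P -> M^T *m X + X *m P = 0 -> X = 0.
Proof.
move=> /hurwitz_tr /hurwitz_stable hM /hurwitz_stable hP e.
apply: cplx_inj; rewrite cplx0.
by apply: (sylvester_injC hM hP); rewrite -!cplxM -cplxD e cplx0.
Qed.

(** An injective linear endomorphism of a finite-dimensional space is onto; [lin_mx] provides its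
    matrix. *)
Lemma sylvester_solvable m n (M : 'M[R]_m) (P : 'M[R]_n) Q :
  hurwitz M -> hurwitz P -> exists X, M^T *m X + X *m P = Q.
Proof.
move=> hM hP.
pose f : 'M[R]_(m, n) -> 'M[R]_(m, n) := mulmx M^T \+ mulmxr P.
have uf : lin_mx f \in unitmx.
  rewrite -row_free_unit; apply/inj_row_free => v.
  rewrite -[v]vec_mxK mul_vec_lin => /eqP; rewrite mxvec_eq0 => /eqP /= e.
  by rewrite (sylvester_inj hM hP e) linear0.
exists (vec_mx (mxvec Q *m invmx (lin_mx f))).
apply: (can_inj mxvecK).
by rewrite -(mul_vec_lin f) vec_mxK mulmxKV.
Qed.

End Cplx.

Section Lyapunov.
Variable C : numClosedFieldType.

Lemma adj_block m1 m2 n1 n2 (P : 'M[C]_(m1, n1)) Q S (T : 'M[C]_(m2, n2)) :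
  adj (block_mx P Q S T) = block_mx (adj P) (adj S) (adj Q) (adj T).
Proof. by rewrite /adj tr_block_mx map_block_mx. Qed.

Lemma adj_col m1 m2 n (P : 'M[C]_(m1, n)) (Q : 'M[C]_(m2, n)) :
  adj (col_mx P Q) = row_mx (adj P) (adj Q).
Proof. by rewrite /adj tr_col_mx map_row_mx. Qed.

Lemma adj_scalar n (z : C) : adj (z%:M : 'M_n) = (Num.conj z)%:M.
Proof. by rewrite /adj tr_scalar_mx map_scalar_mx. Qed.

Lemma mulmx_adjE n (v : 'rV[C]_n) :
  (v *m adj v) 0 0 = \sum_j `|v 0 j| ^+ 2.
Proof. by rewrite mxE; apply: eq_bigr => j _; rewrite !mxE normCK. Qed.

Lemma mulmx_adj_ge0 n (v : 'rV[C]_n) : 0 <= (v *m adj v) 0 0.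
Proof. by rewrite mulmx_adjE sumr_ge0 // => j _; rewrite exprn_ge0. Qed.

Lemma mulmx_adj_eq0 n (v : 'rV[C]_n) : (v *m adj v) 0 0 = 0 -> v = 0.
Proof.
rewrite mulmx_adjE => /psumr_eq0P h; apply/rowP => j; apply/eqP.
by rewrite mxE -normr_eq0 -sqrf_eq0 h // => i _; rewrite exprn_ge0.
Qed.

Lemma stable_trig k (M : 'M[C]_k) :
  is_trig_mx M -> (forall i, M i i + (M i i)^* < 0) -> stable M.
Proof.
move=> tM hM z; rewrite eigenvalue_root_char char_poly_trig //.
rewrite -(big_map (fun i => M i i) xpredT (fun w => 'X - w%:P)) root_prod_XsubC.
by case/mapP => i _ ->.
Qed.

(* Cholesky factorization along the triangular structure: the Schur complement
   of the leading entry of X solves a Lyapunov equation of smaller size. *)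
Lemma lyapunov_trig k j (M X : 'M[C]_k) (G : 'M[C]_(k, j)) :
    is_trig_mx M -> (forall i, M i i + (M i i)^* < 0) -> adj X = X ->
    M *m X + X *m adj M + G *m adj G = 0 ->
  exists T : 'M_k, X = T *m adj T.
Proof.
elim: k j M X G => [|k ih] j M X G; first by exists 0; rewrite (flatmx0 X) mul0mx.
rewrite -[k.+1]/(1 + k)%N in M X G *.
rewrite -[M]submxK -[X]submxK -[G]vsubmxK adj_block.
move: (ulsubmx M) (ursubmx M) (dlsubmx M) (drsubmx M) => l z a m.
move: (ulsubmx X) (ursubmx X) (dlsubmx X) (drsubmx X) => x bs b X2.
move: (usubmx G) (dsubmx G) => g1 g2.
rewrite is_trig_block_mx // => /and3P [/eqP -> _ tm] hre.
have hl : l 0 0 + (l 0 0)^* < 0 by have := hre (lshift k 0); rewrite block_mxEul.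
have hm i : m i i + (m i i)^* < 0.
  by have := hre (rshift 1%N i); rewrite block_mxEdr.
move=> {hre} /eq_block_mx [hx hb _ hX2]; subst bs; move: hx.
rewrite [l]mx11_scalar [x]mx11_scalar in hl *; rewrite mxE eqxx mulr1n in hl.
move: (l 0 0) (x 0 0) hl => lam xi hl; rewrite adj_scalar.
move=> /matrixP /(_ 0 0); rewrite !mxE eqxx !mulr1n => rxi.
rewrite adj_block adj_col adj0 adj_scalar !mulmx_block mul_col_row !mul0mx !mulmx0.
rewrite !addr0 !add_block_mx -[0 in RHS]block_mx0 => /eq_block_mx [e11 _ e21 e22].
have {}e11 : (lam + lam^*) * xi + (g1 *m adj g1) 0 0 = 0.
  move/matrixP: e11 => /(_ 0 0); rewrite !addmxE -!scalar_mxM [_%:M _ _]mxE.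
  by rewrite [_%:M 0 0]mxE eqxx !mulr1n [RHS]mxE => <-; ring.
have hg := mulmx_adj_ge0 g1.
have xi_ge0 : 0 <= xi.
  rewrite -(nmulr_rle0 _ hl) -oppr_ge0; move/eqP: e11; rewrite addr_eq0 => /eqP ->.
  by rewrite opprK.
(* With a vanishing pivot the first row of [G] vanishes too, so [b] solves a homogeneous Sylvester
   equation with stable coefficients: the first row and column of [X] are zero. *)
have [xi0|xi_neq0] := eqVneq xi 0.
  move: e11; rewrite xi0 mulr0 add0r => /mulmx_adj_eq0 g10.
  have b0 : b = 0.
    apply: (sylvester_injC (stable_trig tm hm) (P := (lam^*)%:M)).
      rewrite -adj_scalar; apply: stable_adj; apply: stable_trig; first exact: scalar_mx_is_trig.
      by move=> i; rewrite mxE eqxx mulr1n.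
    by move: e21; rewrite g10 xi0 adj0 mulmx0 addr0 raddf0 mulmx0 add0r.
  have [|T eT] := ih _ _ X2 g2 tm hm hX2.
    by move: e22; rewrite b0 adj0 mulmx0 mul0mx !add0r.
  exists (block_mx 0 0 0 T); rewrite adj_block mulmx_block !adj0 !mulmx0 !mul0mx.
  by rewrite !add0r -eT b0 adj0 raddf0.
have eb : m *m b = - (xi *: a + lam^* *: b + g2 *m adj g1).
  apply/eqP; rewrite -addr_eq0 -e21 mul_mx_scalar mul_mx_scalar; apply/eqP; mxabel.
have ebs : adj b *m adj m = - (xi *: adj a + lam *: adj b + g1 *m adj g2).
  by rewrite -adjM eb adjN !adjD !adjZ adjM adjK conjCK rxi.
have hxi : Num.conj xi^-1 = xi^-1 by rewrite rmorphV ?unitfE //= rxi.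
pose S := X2 - xi^-1 *: (b *m adj b).
(* The forcing term undergoes the same elimination as [X], which turns [g2] into
   [g2 - xi^-1 b g1]. *)
have [||T eT] := ih _ m S (g2 - xi^-1 *: (b *m g1)) tm hm.
- by rewrite /S adjD adjN adjZ adjM adjK hX2 hxi.
- have egg : g1 *m adj g1 = (- ((lam + lam^*) * xi))%:M.
    rewrite [LHS]mx11_scalar; congr _%:M.
    by apply/eqP; rewrite -addr_eq0 addrC e11.
  have e22' : m *m X2 = - (a *m adj b + b *m adj a + X2 *m adj m + g2 *m adj g2).
    by apply/eqP; rewrite -addr_eq0 -e22; apply/eqP; mxabel.
  rewrite /S adjD adjN adjZ adjM hxi.
  rewrite !(mulmxDl, mulmxDr, mulmxN, mulNmx, =^~scalemxAl, =^~scalemxAr).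
  rewrite !mulmxA eb -[_ *m adj b *m adj m]mulmxA ebs e22'.
  rewrite -[_ *m g1 *m adj g1]mulmxA egg.
  rewrite !(mulmxDl, mulmxDr, mulmxN, mulNmx, =^~scalemxAl, =^~scalemxAr).
  rewrite mul_mx_scalar -!scalemxAl !mulmxA.
  apply/matrixP => ? ?; rewrite ?(addmxE, oppmxE, zeromxE, scalemxE); field.
  exact: xi_neq0.
exists (block_mx (sqrtC xi)%:M 0 ((sqrtC xi)^-1 *: b) T).
have hs : Num.conj (sqrtC xi) = sqrtC xi by apply/CrealP/ger0_real; rewrite sqrtC_ge0.
have hs0 : sqrtC xi != 0 by rewrite sqrtC_eq0.
rewrite adj_block mulmx_block adj_scalar adj0 adjZ !mulmx0 !mul0mx !addr0 -eT hs.
have -> : Num.conj (sqrtC xi)^-1 = (sqrtC xi)^-1 by rewrite rmorphV ?unitfE //= hs.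
rewrite -scalar_mxM -expr2 sqrtCK mul_scalar_mx mul_mx_scalar !scalerA mulfV // !scale1r.
congr block_mx; rewrite -scalemxAl -scalemxAr scalerA -invfM -expr2 sqrtCK /S.
by rewrite addrC subrK.
Qed.

(** A unitary Schur form reduces to the triangular case; the factorization stands in for the
    integral representation of [X] by matrix exponentials. *)
Lemma lyapunov_adj k j (M X : 'M[C]_k) (G : 'M[C]_(k, j)) :
    stable M -> adj X = X -> M *m X + X *m adj M + G *m adj G = 0 ->
  exists T : 'M_k, X = T *m adj T.
Proof.
case: k => [|k] in M X G * => hM sX e.
  by exists 0; rewrite (flatmx0 X) mul0mx.
have [P uP] := Schur M (isT : (0 < k.+1)%N).
rewrite /similar_to /= conjymx // -/(adj P) => tP.
have {}uP : P *m adj P = 1%:M by apply/unitarymxP.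
have uP' : adj P *m P = 1%:M by apply: mulmx1C.
have conjM (Y Z : 'M_k.+1) : P *m Y *m adj P *m (P *m Z *m adj P) = P *m (Y *m Z) *m adj P.
  by rewrite !mulmxA -[_ *m adj P *m P]mulmxA uP' mulmx1.
have [|||T eT] := @lyapunov_trig _ _ _ (P *m X *m adj P) (P *m G) tP.
- move=> i; suff : stable (P *m M *m adj P).
    move=> /(_ ((P *m M *m adj P) i i)); apply.
    rewrite eigenvalue_root_char char_poly_trig //.
    rewrite -(big_map (fun i => (P *m M *m adj P) i i) xpredT
               (fun w => 'X - w%:P)) root_prod_XsubC.
    by apply/mapP; exists i; rewrite ?mem_index_enum.
  move=> z /eigenvalueP [w ew nzw]; apply: hM.
  apply/eigenvalueP; exists (w *m P).
    by rewrite scalemxAl -ew !mulmxA -[RHS]mulmxA uP' mulmx1.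
  by apply: contraNneq nzw => e0; rewrite -[w]mulmx1 -uP mulmxA e0 mul0mx.
- by rewrite !adjM adjK sX mulmxA.
- have -> : adj (P *m M *m adj P) = P *m adj M *m adj P.
    by rewrite !adjM adjK mulmxA.
  have -> : P *m G *m adj (P *m G) = P *m (G *m adj G) *m adj P by rewrite adjM !mulmxA.
  rewrite !conjM.
  by rewrite -!mulmxDl -!mulmxDr e mulmx0 mul0mx.
exists (adj P *m T).
rewrite adjM adjK mulmxA -[adj P *m T *m adj T]mulmxA -eT !mulmxA uP' mul1mx.
by rewrite -mulmxA uP' mulmx1.
Qed.

End Lyapunov.

Section RealLyapunov.
Variable R : realType.

(** The factor [T] of the complexification may be complex, but [v^T X v] is the squared norm of
    [v^T T]. *)
Lemma lyapunov_psd k j (M X : 'M[R]_k) (Q : 'M[R]_(j, k)) :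
  hurwitz M -> X^T = X -> M^T *m X + X *m M + Q^T *m Q = 0 -> psd X.
Proof.
move=> hM sX e; split=> // v.
have [||T eT] := @lyapunov_adj _ _ _ _ (cplx X) (cplx Q^T)
  (proj1 (hurwitz_stable _) (hurwitz_tr hM)).
- by rewrite adj_cplx -cplx_tr sX.
- by rewrite !adj_cplx -!cplx_tr !trmxK -!cplxM -!cplxD e cplx0.
have := mulmx_adj_ge0 (cplx v^T *m T).
rewrite adjM adj_cplx -cplx_tr trmxK mulmxA -[_ *m T *m _]mulmxA -eT.
by rewrite -!cplxM mxE ler0c.
Qed.

End RealLyapunov.

(** * Stable invariant subspaces of Hamiltonian matrices *)

Section Hamiltonian.
Variable C : numClosedFieldType.

Lemma mulmx_adj_mx_eq0 m n (M : 'M[C]_(m, n)) : M *m adj M = 0 -> M = 0.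
Proof.
move=> e; apply/row_matrixP => i; rewrite row0; apply: mulmx_adj_eq0.
rewrite rowE adjM mulmxA -[_ *m M *m _]mulmxA e.
by rewrite mulmx0 mul0mx mxE.
Qed.

Lemma eigenvector_horner d (M : 'M[C]_d.+1) (v : 'rV_d.+1) z f :
  v *m M = z *: v -> v *m horner_mx M f = f.[z] *: v.
Proof.
move=> e; elim/poly_ind: f => [|g c ih]; first by rewrite rmorph0 mulmx0 horner0 scale0r.
rewrite rmorphD rmorphM /= horner_mx_X horner_mx_C mulmxDr mulmxA ih.
by rewrite -scalemxAl e scalerA mul_mx_scalar -scalerDl !hornerE.
Qed.

(** The characteristic polynomial is split by the sign of the real part of its roots into coprime
    factors [p] and [q]. Their kernels at [M] are complementary invariant row spaces, and [L1], [L2]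
    represent [M] on bases of them. *)
Lemma spectral_split d (M : 'M[C]_d) :
  (forall z, eigenvalue M z -> z + z^* <> 0) ->
  exists k1 k2 (U : 'M[C]_(k1, d)) (L1 : 'M_k1) (W : 'M[C]_(k2, d)) (L2 : 'M_k2),
    [/\ (k1 + k2 = d)%N, row_free U /\ row_free W,
        U *m M = L1 *m U /\ W *m M = L2 *m W, stable L1 & stable (- L2)].
Proof.
case: d M => [|d] M hM.
  exists 0%N, 0%N, 0, 0, 0, 0.
  have h : stable (0 : 'M[C]_0).
    by move=> z /eigenvalueP [v _]; rewrite (thinmx0 v) eqxx.
  split; rewrite ?oppr0 //; first by split; rewrite -row_leq_rank.
  by rewrite !(flatmx0 (_ *m _)).
have [zs ezs] := closed_field_poly_normal (char_poly M).
rewrite (monicP (char_poly_monic M)) scale1r in ezs.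
have root_zs z : (z \in zs) = eigenvalue M z.
  by rewrite eigenvalue_root_char ezs root_prod_XsubC.
pose neg z := (z : C) + z^* < 0.
pose p := \prod_(z <- filter neg zs) ('X - z%:P).
pose q := \prod_(z <- filter (predC neg) zs) ('X - z%:P).
have epq : p * q = char_poly M by rewrite ezs (bigID neg) /= /p /q !big_filter.
have cpq : coprimep p q.
  rewrite coprimep_sym /p big_seq; apply: (@big_ind _ (coprimep q)) => [|f g hf hg|z].
  - exact: coprimep1.
  - by rewrite coprimepMr hf.
  - rewrite mem_filter => /andP [hz _].
    by rewrite coprimep_XsubC root_prod_XsubC mem_filter /= hz.
have h1 : (kermxpoly M p + kermxpoly M q :=: 1%:M)%MS.
  apply: eqmx_trans (eqmx_sym (kermxpolyM M cpq)) _; rewrite epq.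
  by apply: kermxpoly_min; rewrite dvd_mxminpoly Cayley_Hamilton.
have h2 := mxdirect_kermxpoly M cpq.
have key (f : {poly C}) (P : pred C) : f = \prod_(z <- filter P zs) ('X - z%:P) ->
    exists L, row_base (kermxpoly M f) *m M = L *m row_base (kermxpoly M f) /\
       forall z, eigenvalue L z -> eigenvalue M z && P z.
  move=> ef; set U := row_base _.
  have sU : stablemx U M by rewrite stablemx_row_base; apply: comm_mx_stable_kermxpoly.
  exists (U *m M *m pinvmx U); rewrite mulmxKpV //; split=> // z.
  case/eigenvalueP => v ev nzv.
  have nzvU : v *m U != 0 by rewrite mulmx_free_eq0 ?row_base_free.
  have evU : v *m U *m M = z *: (v *m U).
    by rewrite scalemxAl -ev -[RHS]mulmxA mulmxKpV // mulmxA.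
  have -> /= : eigenvalue M z by apply/eigenvalueP; exists (v *m U).
  have : root f z.
    have : v *m U *m horner_mx M f = 0.
      by apply/sub_kermxP; rewrite (submx_trans (submxMl _ _)) // eq_row_base.
    rewrite (eigenvector_horner _ evU).
    by move/eqP; rewrite scaler_eq0 (negPf nzvU) orbF.
  by rewrite ef root_prod_XsubC mem_filter => /andP [].
have [L1 [eL1 hL1]] := key p neg erefl.
have [L2 [eL2 hL2]] := key q (predC neg) erefl.
exists (\rank (kermxpoly M p)), (\rank (kermxpoly M q)), (row_base (kermxpoly M p)), L1,
  (row_base (kermxpoly M q)), L2; split.
- by rewrite -(mxrank_disjoint_sum h2) h1 mxrank1.
- by split; apply: row_base_free.
- exact: (conj eL1 eL2).
- by move=> z /hL1 /andP [].
- move=> z hz; have /hL2 /andP [hMz /=] : eigenvalue L2 (- z).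
    case/eigenvalueP: hz => v ev nzv; apply/eigenvalueP; exists v => //.
    by rewrite scaleNr -ev mulmxN opprK.
  rewrite /neg -addCJ_ge0 le_eqVlt eq_sym => /orP [/eqP /(hM _ hMz) //|].
  by rewrite rmorphN /= -opprD oppr_gt0.
Qed.

Lemma exists_eigenvector_in k (V L : 'M[C]_k) : V != 0 -> stablemx V L ->
  exists z (v : 'rV_k), [/\ v != 0, (v <= V)%MS & v *m L = z *: v].
Proof.
move=> nzV sV; have rV : (0 < \rank V)%N by rewrite lt0n mxrank_eq0.
have sU : stablemx (row_base V) L by rewrite stablemx_row_base.
have [z /eigenvalueP [w ew nzw]] :=
  eigenvalue_closed (row_base V *m L *m pinvmx (row_base V)) rV.
exists z, (w *m row_base V); split.
- by rewrite mulmx_free_eq0 ?row_base_free.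
- by rewrite (submx_trans (submxMl _ _)) // eq_row_base.
- by rewrite scalemxAl -ew -[RHS]mulmxA mulmxKpV // mulmxA.
Qed.

Section Stable.
Variables (a c : nat) (A : 'M[C]_a) (S P : 'M[C]_(c, a)).
Hypotheses (realA : adj A = A^T) (realS : adj S = S^T) (realP : adj P = P^T).
(** Hautus test for stabilizability of the pair [A], [S^T]; [obsA] is the observability test for
    imaginary-axis modes. *)
Hypothesis stabA : forall z (y : 'rV[C]_a), y *m A = z *: y ->
  y *m S^T = 0 -> 0 <= z + z^* -> y = 0.
Hypothesis obsA : forall z (x : 'cV[C]_a), z + z^* = 0 ->
  A *m x = z *: x -> P *m x = 0 -> x = 0.

(** The usual Hamiltonian matrix transposed, because eigenspaces are row spaces here: the rows of
    [[1 X]] span an invariant space exactly when [X] solves the Riccati equation. *)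
Let Ham : 'M[C]_(a + a) := block_mx (A^T) (- (P^T *m P))
                                    (- (S^T *m S)) (- A).
Let J : 'M[C]_(a + a) := block_mx 0 1%:M (- 1%:M) 0.

(** Pairing the two components of an eigenvector crosswise cancels the terms in [A] and those in
    [z]; what remains is a sum of two squared norms. Then [obsA] kills [y1], and [stabA] at [- z]
    kills [y2]. *)
Lemma ham_not_imaginary z : eigenvalue Ham z -> z + z^* <> 0.
Proof.
case/eigenvalueP => v ev nzv hz; case/eqP: nzv; move: ev; rewrite -[v]hsubmxK.
move: (lsubmx v) (rsubmx v) => y1 y2.
rewrite mul_row_block scale_row_mx => /eq_row_mx []; rewrite !mulmxN => e1 e2.
have f1 := congr1 (fun M => M *m adj y2) e1.
have f2 := congr1 (fun M => adj (M *m adj y1)) e2.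
have g : y1 *m P^T *m adj (y1 *m P^T) + y2 *m S^T *m adj (y2 *m S^T) = 0.
  have : (z + z^*) *: (y1 *m adj y2) = 0 by rewrite hz scale0r.
  rewrite scalerDl; move: f1 f2 => /=.
  rewrite !adjM !adjK adjZ adjD !adjN !adjM -!adj_tr !realA !realS !realP !trmxK.
  rewrite -scalemxAr -scalemxAl => <- <-.
  rewrite !mulmxDl !mulmxDr !mulmxN !mulNmx !mulmxA => h.
  by rewrite -[RHS]oppr0 -h; mxabel.
have {g} := congr1 (fun M : 'M_1 => M 0 0) g; rewrite addmxE [RHS]mxE => /eqP.
rewrite paddr_eq0 ?mulmx_adj_ge0 // => /andP [/eqP /mulmx_adj_eq0 g1 /eqP /mulmx_adj_eq0 g2].
have y10 : y1 = 0.
  apply: trmx_inj; rewrite trmx0; apply: (@obsA z) => //.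
    by rewrite -[A]trmxK -trmx_mul -linearZ -e1 mulmxA g2 mul0mx subr0.
  by rewrite -[P]trmxK -trmx_mul g1 trmx0.
rewrite y10; suff -> : y2 = 0 by rewrite row_mx0.
apply: (@stabA (- z)) => //; last by rewrite rmorphN /= -opprD hz oppr0.
by rewrite scaleNr -e2 y10 mul0mx oppr0 add0r opprK.
Qed.

Lemma ham_skew : Ham *m J = - (J *m Ham^T).
Proof.
rewrite /Ham /J tr_block_mx !mulmx_block !trmxN !trmx_mul !trmxK.
rewrite !(mulmx0, mul0mx, mulmx1, mul1mx, mulNmx, mulmxN, add0r, addr0).
by rewrite opp_block_mx !opprK.
Qed.

(** For either form, the Gram matrix of an invariant space solves a homogeneous Sylvester equation
    whose coefficients are [L] and its transpose or adjoint. The matrix [M] is general so that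
    [- Ham], hence the antistable space, is covered. *)
Lemma ham_isotropic k (U : 'M[C]_(k, a + a)) (L : 'M_k) (M : 'M[C]_(a + a)) :
  stable L -> U *m M = L *m U -> M *m J = - (J *m M^T) -> adj M = M^T ->
  U *m J *m U^T = 0 /\ U *m J *m adj U = 0.
Proof.
move=> hL eU hJ aM; split.
  apply: (sylvester_injC hL (stable_tr hL)).
  rewrite !mulmxA -eU -[U *m J *m U^T *m _]mulmxA -trmx_mul -eU.
  rewrite -[U *m M *m J]mulmxA hJ trmx_mul.
  by rewrite !mulmxN !mulNmx !mulmxA addNr.
apply: (sylvester_injC hL (stable_adj hL)).
rewrite !mulmxA -eU -[U *m J *m adj U *m _]mulmxA -adjM -eU.
rewrite -[U *m M *m J]mulmxA hJ adjM aM.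
by rewrite !mulmxN !mulNmx !mulmxA addNr.
Qed.

Lemma J_unit : J \in unitmx.
Proof.
suff h : J *m (- J) = 1%:M by have [] := mulmx1_unit h.
rewrite /J mulmxN mulmx_block !(mulmx0, mul0mx, mulmx1, mulmxN, add0r, addr0).
by rewrite opp_block_mx !oppr0 opprK -scalar_mx_block.
Qed.

(* Applied to the stable and to the antistable space, this bound is attained. *)
Lemma isotropic_rank k (U : 'M[C]_(k, a + a)) :
  row_free U -> U *m J *m U^T = 0 -> (k <= a)%N.
Proof.
move=> fU /mulmx0_rank_max; rewrite mxrank_tr mxrankMfree ?row_free_unit ?J_unit //.
move: fU => /eqP ->; lia.
Qed.

(* The rows of [U1 U2] span the stable invariant row space of Ham.  It is isotropic
   for both the bilinear and the sesquilinear form of J, so that U1^-1 U2 is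
   symmetric and Hermitian, hence real. *)
Lemma riccati_hamiltonian : exists X : 'M[C]_a,
  [/\ X^T = X, adj X = X,
      A^T *m X + X *m A - X *m (S^T *m S) *m X + P^T *m P = 0 &
      stable (A - S^T *m S *m X)].
Proof.
have aH : adj Ham = Ham^T.
  rewrite /Ham adj_block tr_block_mx !adjN !adjM -!adj_tr realA realS realP.
  by rewrite !trmxN !trmx_mul.
have [k1 [k2 [U [L [W [L2 [ek [fU fW] [eU eW] hL hL2]]]]]]] :=
  spectral_split ham_not_imaginary.
have [iU iU'] := ham_isotropic hL eU ham_skew aH.
have [iW _] : W *m J *m W^T = 0 /\ W *m J *m adj W = 0.
  apply: (ham_isotropic (M := - Ham) hL2).
  - by rewrite mulmxN eW mulNmx.
  - by rewrite mulNmx ham_skew trmxN mulmxN.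
  - by rewrite adjN aH trmxN.
have ek1 : k1 = a by have := isotropic_rank fU iU; have := isotropic_rank fW iW; lia.
subst k1; move: {ek W L2 fW eW hL2 iW} fU eU iU iU'.
rewrite -[U]hsubmxK; move: (lsubmx U) (rsubmx U) => {U} U1 U2 fU.
rewrite mul_row_block mul_mx_row => /eq_row_mx []; rewrite !mulmxN => e1 e2.
rewrite mul_row_block tr_row_mx /adj tr_row_mx map_col_mx !mul_row_col.
rewrite -!/(adj _) !(mulmx0, mulmx1, mulmxN, mulNmx, add0r, addr0).
move=> /eqP; rewrite addrC subr_eq0 => /eqP i1 /eqP; rewrite addrC subr_eq0 => /eqP i2.
(* Isotropy gives [Z0], so the kernel of [U1] is invariant under [L]. An eigenvector [v] in it, at
   [z], makes [v U2] a left eigenvector of [A] at [- z] annihilated by [S^T]; then [v U2 = 0],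
   against the independence of the rows of [U]. *)
have uU1 : U1 \in unitmx.
  rewrite -row_free_unit -kermx_eq0; apply: contraT => nzK.
  have kU : kermx U1 *m U1 = 0 by apply: mulmx_ker.
  have Z0 : kermx U1 *m U2 *m S^T = 0.
    move: (kermx U1) kU => Z kU.
    apply: mulmx_adj_mx_eq0; rewrite !adjM -adj_tr realS trmxK !mulmxA.
    rewrite -[_ *m S^T *m S]mulmxA.
    have -> : Z *m U2 *m (S^T *m S) = - (Z *m L *m U1).
      by rewrite -[_ *m L *m U1]mulmxA -e1 mulmxBr !mulmxA kU mul0mx sub0r opprK.
    rewrite !mulNmx -[_ *m U1 *m adj U2]mulmxA i2 -!mulmxA -adjM kU adj0.
    by rewrite !mulmx0 oppr0.
  have sK : stablemx (kermx U1) L.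
    apply/sub_kermxP; rewrite -mulmxA -e1 mulmxBr !mulmxA kU mul0mx sub0r.
    by rewrite Z0 mul0mx oppr0.
  have [z [v [nzv vK ev]]] := exists_eigenvector_in nzK sK.
  have hz : z + z^* < 0 by apply: hL; apply/eigenvalueP; exists v.
  have vU1 : v *m U1 = 0 by apply/sub_kermxP.
  have vU2 : v *m U2 = 0.
    have [D eD] := submxP vK.
    apply: (@stabA (- z)).
    - rewrite scaleNr scalemxAl -ev -[_ *m L *m _]mulmxA -e2 mulmxBr mulmxN !mulmxA.
      by rewrite vU1 !mul0mx oppr0 add0r opprK.
    - by move: Z0; rewrite eD -!mulmxA => ->; rewrite mulmx0.
    - by rewrite rmorphN /= -opprD oppr_ge0 ltW.
  have : v *m row_mx U1 U2 = 0 by rewrite mul_mx_row vU1 vU2 row_mx0.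
  by move/eqP; rewrite mulmx_free_eq0 // (negPf nzv).
pose X := invmx U1 *m U2.
have eX : U2 = U1 *m X by rewrite mulKVmx.
have symX : X^T = X.
  have uU1t : U1^T \in unitmx by rewrite unitmx_tr.
  apply: (can_inj (mulKmx uU1)); apply: (can_inj (mulmxK uU1t)).
  by rewrite -mulmxA -trmx_mul -eX i1.
have herX : adj X = X.
  have uaU1 : adj U1 \in unitmx by rewrite /adj map_unitmx unitmx_tr.
  apply: (can_inj (mulKmx uU1)); apply: (can_inj (mulmxK uaU1)).
  by rewrite -mulmxA -adjM -eX i2.
(* The transposed closed loop is similar to [L], which gives both the Riccati equation and
   stability. *)
have eN : A^T - X *m (S^T *m S) = invmx U1 *m L *m U1.
  by rewrite -mulmxA -e1 mulmxBr mulKmx // /X !mulmxA.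
have sN : stable (A^T - X *m (S^T *m S)).
  rewrite eN => z /eigenvalueP [v ev nzv]; apply: hL; apply/eigenvalueP.
  exists (v *m invmx U1).
    by rewrite scalemxAl -ev !mulmxA mulmxK.
  by apply: contraNneq nzv => e0; rewrite -[v](mulmxKV uU1) e0 mul0mx.
exists X; split=> //.
- have : (A^T - X *m (S^T *m S)) *m X = - (P^T *m P) - X *m A.
    rewrite eN -[_ *m U1 *m X]mulmxA -eX -[_ *m L *m U2]mulmxA -e2 mulmxBr mulmxN.
    by rewrite mulKmx // /X !mulmxA.
  move=> /eqP; rewrite mulmxBl -subr_eq0 => /eqP <-; mxabel.
- rewrite -[A - _]trmxK; apply: stable_tr.
  by rewrite trmxD trmxN (trmx_mul _ X) symX trmx_mul trmxK.
Qed.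

End Stable.
End Hamiltonian.

(** * Stabilizing solutions of Riccati equations *)

Section Riccati.
Local Open Scope complex_scope.
Variable R : realType.
Local Notation C := R[i].

Lemma mulmx_tr_eq0 m n (M : 'M[R]_(m, n)) : M *m M^T = 0 -> M = 0.
Proof.
move=> e; apply: cplx_inj; rewrite cplx0; apply: mulmx_adj_mx_eq0.
by rewrite adj_cplx -cplx_tr -cplxM e cplx0.
Qed.

Lemma gram_unit m n (H : 'M[R]_(m, n)) : row_full H -> H^T *m H \in unitmx.
Proof.
rewrite -row_free_unit => /row_fullP [P eP]; apply/inj_row_free => v e.
have e0 : v *m H^T = 0.
  by apply: mulmx_tr_eq0; rewrite trmx_mul trmxK mulmxA -(mulmxA v) e mul0mx.
by rewrite -[v]mulmx1 -trmx1 -eP trmx_mul mulmxA e0 mul0mx.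
Qed.

Lemma row_full_mulr m n k (H : 'M[R]_(m, n)) (D : 'M_(n, k)) :
  row_full H -> D^T *m D = 1%:M -> row_full (H *m D).
Proof.
move=> /row_fullP [P eP] eD; apply/row_fullP; exists (D^T *m P).
by rewrite mulmxA -(mulmxA D^T) eP mulmx1.
Qed.

Lemma row_full_cplx_inj m n k (H : 'M[R]_(m, n)) (u : 'M[C]_(n, k)) :
  row_full H -> cplx H *m u = 0 -> u = 0.
Proof.
move=> /row_fullP [P eP] e.
have -> : u = cplx (P *m H) *m u by rewrite eP /cplx map_mx1 mul1mx.
by rewrite cplxM -mulmxA e mulmx0.
Qed.

(* z is not an invariant zero of (A, B, F, H). *)
Definition no_zero a b c (A : 'M[R]_a) (B : 'M[R]_(a, b)) (F : 'M[R]_(c, a))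
    (H : 'M[R]_(c, b)) (z : C) :=
  forall (x : 'cV[C]_a) (u : 'cV[C]_b),
    cplx A *m x + cplx B *m u = z *: x -> cplx F *m x + cplx H *m u = 0 -> x = 0.

Lemma no_zero_pencil a b c (A : 'M[R]_a) (B : 'M[R]_(a, b)) (F : 'M[R]_(c, a))
    (H : 'M[R]_(c, b)) z :
  row_full (block_mx (cplx A - z%:M) (cplx B) (cplx F) (cplx H)) ->
  no_zero A B F H z.
Proof.
move=> /row_fullP [P eP] x u e1 e2.
have : P *m block_mx (cplx A - z%:M) (cplx B) (cplx F) (cplx H) *m col_mx x u = 0.
  rewrite -mulmxA mul_block_col e2 mulmxBl mul_scalar_mx addrAC e1 subrr.
  by rewrite col_mx0 mulmx0.
by rewrite eP mul1mx -col_mx0 => /eq_col_mx [].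
Qed.

Lemma quadratic_form_addi (F : comNzRingType) a (M : 'M[F]_a) (u v : 'cV_a) i :
  i * i = -1 ->
  (u^T + (- i) *: v^T) *m M *m (u + i *: v) =
    u^T *m M *m u + v^T *m M *m v + i *: (u^T *m M *m v - v^T *m M *m u).
Proof.
move=> ii; rewrite !mulmxDl !mulmxDr -!scalemxAl -!scalemxAr scalerA.
rewrite mulNr ii opprK scale1r; mxabel.
Qed.

(** For [x = u + i v] the cross terms cancel by symmetry of [X], leaving the real forms at [u] and
    [v]. *)
Lemma psd_cplx a (X : 'M[R]_a) (x : 'cV[C]_a) :
  psd X -> 0 <= (adj x *m cplx X *m x) 0 0.
Proof.
move=> [sX pX].
pose u := map_mx (@complex.Re R) x; pose v := map_mx (@complex.Im R) x.
have ex : x = cplx u + 'i *: cplx v.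
  by apply/matrixP => i j; rewrite !mxE [LHS]complexE.
have ii : ('i%C : C) * 'i%C = -1.
  by apply/eqP; rewrite eq_complex /=; apply/andP; split; apply/eqP; ring.
have ci : Num.conj ('i%C : C) = - 'i%C.
  by apply/eqP; rewrite eq_complex /= oppr0 !eqxx.
have -> : adj x *m cplx X *m x =
    cplx (u^T *m X *m u + v^T *m X *m v)
    + 'i *: (cplx (u^T *m X *m v) - cplx (v^T *m X *m u)).
  rewrite ex adjD adjZ !adj_cplx ci (quadratic_form_addi _ _ _ ii) cplxD !cplxM.
  by rewrite !cplx_tr.
have -> : v^T *m X *m u = u^T *m X *m v.
  rewrite [LHS]mx11_scalar -[LHS]tr_scalar_mx -mx11_scalar !trmx_mul sX trmxK.
  exact: mulmxA.
rewrite subrr scaler0 addr0 mxE ler0c addmxE.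
by rewrite addr_ge0 ?pX.
Qed.

Lemma riccati_hamiltonian_real a c (A : 'M[R]_a) (S P : 'M[R]_(c, a)) :
    (forall z (y : 'rV[C]_a), y *m cplx A = z *: y -> y *m cplx S^T = 0 ->
       0 <= complex.Re z -> y = 0) ->
    (forall z (x : 'cV[C]_a), complex.Re z = 0 -> cplx A *m x = z *: x ->
       cplx P *m x = 0 -> x = 0) ->
  exists X : 'M[R]_a,
  [/\ X^T = X, A^T *m X + X *m A - X *m (S^T *m S) *m X + P^T *m P = 0 &
      hurwitz (A - S^T *m S *m X)].
Proof.
move=> hS hP.
have Re0 z : z + Num.conj z = 0 -> complex.Re z = 0.
  by case: z => x y /eqP; rewrite eq_complex /= => /andP [/eqP h _]; lra.
have [|||||X [sX aX eX hX]] := @riccati_hamiltonian _ _ _ (cplx A) (cplx S) (cplx P).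
- exact: adj_cplx.
- exact: adj_cplx.
- exact: adj_cplx.
- by move=> z y ey eS; rewrite addCJ_ge0E; apply: hS; rewrite ?cplx_tr.
- by move=> z x /Re0; apply: hP.
have [Xr eXr] : exists Xr, X = cplx Xr.
  exists (map_mx (@complex.Re R) X); apply/matrixP => i j; rewrite !mxE.
  rewrite RRe_real //; apply/CrealP.
  by rewrite -[in RHS]aX [in RHS]mxE -{1}sX.
exists Xr; split.
- by apply: cplx_inj; rewrite cplx_tr -eXr.
- by apply: cplx_inj; rewrite !(cplxD, cplxN, cplxM, cplx_tr) cplx0 -eXr.
- by apply/hurwitz_stable; rewrite !(cplxD, cplxN, cplxM, cplx_tr) -eXr.
Qed.

Section Equation.
Variables (a b c : nat) (A : 'M[R]_a) (B : 'M[R]_(a, b)) (F : 'M[R]_(c, a))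
  (H : 'M[R]_(c, b)).
Hypothesis fullH : row_full H.

Let G := H^T *m H.
Let uG : G \in unitmx. Proof. exact: gram_unit. Qed.
Let symG : G^T = G. Proof. by rewrite trmx_mul trmxK. Qed.

(** The inverse of [G] is traded for a gain equation and the quadratic term is absorbed by the
    closed loop. For given [K] this form is linear in [X], so it can be cut into blocks. *)
Lemma AREpE X K : AREp A B F H X K <->
  [/\ X^T = X, G *m K = - (B^T *m X + H^T *m F) &
      A^T *m X + X *m (A + B *m K) + F^T *m (F + H *m K) = 0].
Proof.
have eT : X^T = X -> (X *m B + F^T *m H)^T = B^T *m X + H^T *m F.
  by move=> sX; rewrite trmxD !trmx_mul sX trmxK.
have eK (S : 'M_(b, a)) : G *m K = - S <-> K = - (invmx G *m S).
  split=> [e|->]; last by rewrite mulmxN mulKVmx.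
  by rewrite -(mulKmx uG K) e mulmxN.
split=> [[sX e eK']|[sX e1 e2]].
  have hK : G *m K = - (B^T *m X + H^T *m F) by apply/eK; rewrite -eT.
  split=> //; rewrite -e -[_ *m invmx _ *m _]mulmxA -[invmx _ *m _]opprK -eK'.
  by rewrite mulmxN opprK !mulmxDr !mulmxDl !mulmxA; mxabel.
have hK : K = - (invmx G *m (X *m B + F^T *m H)^T) by apply/eK; rewrite eT.
split=> //; rewrite -e2 -[_ *m invmx _ *m _]mulmxA -[invmx _ *m _]opprK -hK.
by rewrite mulmxN opprK !mulmxDr !mulmxDl !mulmxA; mxabel.
Qed.

(** Adds [K^T] times the gain equation to the Riccati equation. *)
Lemma AREp_lyapunov X K : AREp A B F H X K ->
  (A + B *m K)^T *m X + X *m (A + B *m K) + (F + H *m K)^T *m (F + H *m K) = 0.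
Proof.
case/AREpE => sX e1 e2; rewrite -[RHS]e2 !trmxD !trmx_mul.
have : K^T *m (G *m K + (B^T *m X + H^T *m F)) = 0 by rewrite e1 addNr mulmx0.
rewrite /G !mulmxDr !mulmxDl !mulmxA => h.
by rewrite -[RHS]addr0 -h; mxabel.
Qed.

Lemma AREp_stabilizing_psd X K :
  AREp A B F H X K -> hurwitz (A + B *m K) -> psd X.
Proof.
move=> h hK; have [sX _ _] := h.
exact: (lyapunov_psd hK sX (AREp_lyapunov h)).
Qed.

(** The difference [D = X' - X] satisfies [(A + B K')^T D + D (A + B K) = 0], a Sylvester equation
    with two Hurwitz coefficients. *)
Lemma AREp_stabilizing_unique X K X' K' :
  AREp A B F H X K -> hurwitz (A + B *m K) ->
  AREp A B F H X' K' -> hurwitz (A + B *m K') -> X' = X /\ K' = K.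
Proof.
move=> /AREpE [sX e1 e2] hK /AREpE [sX' e1' e2'] hK'.
suff eX : X' = X.
  by split=> //; rewrite -(mulKmx uG K) -(mulKmx uG K') e1 e1' eX.
apply/eqP; rewrite -subr_eq0; apply/eqP; apply: (sylvester_inj hK' hK).
have t2' : X' *m A + (A + B *m K')^T *m X' + (F + H *m K')^T *m F = 0.
  by apply: trmx_inj; rewrite trmx0 -e2' !(trmxD, trmx_mul) !trmxK sX' addrC; mxabel.
have t1' : K'^T *m G = - (X' *m B + F^T *m H).
  by apply: trmx_inj; rewrite trmx_mul trmxK symG e1' trmxN trmxD !trmx_mul trmxK sX'.
have s1 : K'^T *m (G *m K + (B^T *m X + H^T *m F)) = 0 by rewrite e1 addNr mulmx0.
have s2 : (K'^T *m G + (X' *m B + F^T *m H)) *m K = 0 by rewrite t1' addNr mul0mx.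
move: t2' e2 s1 s2; rewrite !(trmxD, trmx_mul) !(mulmxDl, mulmxDr, mulmxN, mulNmx) !mulmxA.
move=> t2' e2 s1 s2.
transitivity (0 - 0 + (0 - 0) : 'M[R]_a); last by rewrite subrr addr0.
rewrite -[X in _ = X - _ + _]t2' -[X in _ = _ - X + _]e2.
by rewrite -[X in _ = _ + (X - _)]s2 -[X in _ = _ + (_ - X)]s1; mxabel.
Qed.

(** At a closed-loop eigenvector [x] for [z], the Lyapunov equation says that [2 Re z] times the
    form of [X] at [x], plus the squared norm of [(F + H K) x], is zero. In the closed right half
    plane both terms are nonnegative, so the output vanishes and the pair [x], [K x] would be an
    invariant zero. *)
Lemma AREp_psd_stabilizing X K : AREp A B F H X K -> psd X ->
  (forall z, 0 <= complex.Re z -> no_zero A B F H z) -> hurwitz (A + B *m K).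
Proof.
move=> h pX nz; apply/hurwitz_stable/stable_colP => z x e hz.
have e' : cplx A *m x + cplx B *m (cplx K *m x) = z *: x.
  by rewrite mulmxA -cplxM -mulmxDl -cplxD.
apply: (nz z _ _ (cplx K *m x) e'); first by rewrite -addCJ_ge0E.
rewrite mulmxA -cplxM -mulmxDl -cplxD.
have := congr1 (fun M => adj x *m cplx M *m x) (AREp_lyapunov h).
rewrite cplx0 mulmx0 mul0mx; move: (A + B *m K) (F + H *m K) e {e'} => M Q e.
rewrite !cplxD !cplxM !mulmxDr !mulmxDl !mulmxA !cplx_tr -!adj_cplx -!adjM e.
rewrite -[_ *m cplx M *m x]mulmxA e adjZ -!scalemxAl -scalemxAr.
rewrite -[_ *m cplx Q *m x]mulmxA -scalerDl [z^*%R + z]addrC.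
move=> /matrixP /(_ 0 0); rewrite addmxE scalemxE [RHS]mxE.
have p1 : 0 <= (z + Num.conj z) * (adj x *m cplx X *m x) 0 0.
  by rewrite mulr_ge0 // psd_cplx.
have p2 := mulmx_adj_ge0 (adj (cplx Q *m x)); rewrite adjK in p2.
move/eqP; rewrite paddr_eq0 // => /andP [_ /eqP].
rewrite -{2}[cplx Q *m x]adjK => /mulmx_adj_eq0 h0.
by rewrite -[LHS]adjK h0 adj0.
Qed.

(** The preliminary feedback [- G^-1 H^T F] removes the cross term [F^T H], leaving a problem for
    the Hamiltonian method. *)
Lemma AREp_exists : stabilizable A B ->
  (forall z, complex.Re z = 0 -> no_zero A B F H z) ->
  exists X K, AREp A B F H X K /\ hurwitz (A + B *m K).
Proof.
move=> [K0 hK0] nz.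
pose Gi := invmx G.
have sGi : Gi^T = Gi by rewrite /Gi trmx_inv symG.
pose At := A - B *m Gi *m H^T *m F.
(* This choice gives [S^T S = B G^-1 B^T] without a square root of [G^-1]; [P] is [F] projected onto
   the orthogonal complement of the range of [H]. *)
pose S := H *m Gi *m B^T.
pose P := F - H *m Gi *m H^T *m F.
have eST : S^T *m H = B.
  by rewrite !trmx_mul trmxK sGi mulmxA -!mulmxA mulVmx ?mulmx1.
have [||X [sX eX hX]] := @riccati_hamiltonian_real _ _ At S P.
- move=> z y ey eS hz.
  have yB : y *m cplx B = 0 by rewrite -eST cplxM mulmxA eS mul0mx.
  have : y *m cplx (A + B *m K0) = z *: y.
    rewrite -ey /At !cplxD cplxN !cplxM !mulmxDr !mulmxN !mulmxA yB !mul0mx.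
    by rewrite oppr0.
  by move/(stable_row (proj1 (hurwitz_stable _) hK0)); apply; rewrite addCJ_ge0E.
- move=> z x hz ex eP.
  apply: (nz z hz x (- (cplx (Gi *m H^T *m F) *m x))).
    by rewrite -ex /At cplxD cplxN mulmxDl mulNmx mulmxN !cplxM !mulmxA.
  by rewrite -eP /P cplxD cplxN mulmxDl mulNmx mulmxN !cplxM !mulmxA.
pose K := - (Gi *m (B^T *m X + H^T *m F)).
have eSS : S^T *m S = B *m Gi *m B^T by rewrite /S !mulmxA eST.
have ePP : P^T *m P = F^T *m F - F^T *m H *m Gi *m H^T *m F.
  have GGi : H^T *m H *m Gi = 1%:M by rewrite mulmxV.
  have e1 : Gi *m H^T *m H *m Gi = Gi by rewrite -!mulmxA [H^T *m _]mulmxA GGi mulmx1.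
  rewrite /P trmxD trmxN !trmx_mul !trmxK sGi !mulmxDl !mulmxDr !mulNmx !mulmxN opprK.
  rewrite !mulmxA.
  have -> : F^T *m H *m Gi *m H^T *m H *m Gi *m H^T *m F = F^T *m H *m Gi *m H^T *m F.
    by rewrite -[in RHS]e1 !mulmxA.
  by mxabel.
have eABK : A + B *m K = At - S^T *m S *m X.
  by rewrite eSS /K /At mulmxN !mulmxDr !mulmxA; mxabel.
exists X, K; split; last by rewrite eABK.
apply/AREpE; split=> //; first by rewrite /K mulmxN mulKVmx.
rewrite -eX ePP eSS /K /At trmxD trmxN !trmx_mul !trmxK sGi.
by rewrite !(mulmxDl, mulmxDr, mulmxN, mulNmx) !mulmxA; mxabel.
Qed.

End Equation.
End Riccati.

(** * Block decompositions *)

Section Blocks.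
Local Open Scope complex_scope.
Variable R : realType.
Local Notation C := R[i].

(** A two-block partition given by its coordinate embeddings. Sizes such as [upsz s N] and
    [upsz s i + dnsz N s i.+1] are equal but not convertible, so [block_mx] would need casts. *)
Definition splits a a1 a2 (E1 : 'M[R]_(a, a1)) (E2 : 'M[R]_(a, a2)) : Prop :=
  [/\ E1^T *m E1 = 1%:M, E2^T *m E2 = 1%:M, E1^T *m E2 = 0 &
      E1 *m E1^T + E2 *m E2^T = 1%:M].

Lemma splits_sym a a1 a2 (E1 : 'M[R]_(a, a1)) (E2 : 'M[R]_(a, a2)) :
  splits E1 E2 -> splits E2 E1.
Proof.
move=> [h1 h2 h3 h4]; split=> //; last by rewrite addrC.
by apply: trmx_inj; rewrite trmx_mul trmxK h3 !trmx0.
Qed.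

(** For an eigenvector in the closed right half plane, the component along [E1] is governed by the
    first diagonal block alone and vanishes; then so does the one along [E2]. *)
Lemma hurwitz_block a a1 a2 (E1 : 'M[R]_(a, a1)) (E2 : 'M[R]_(a, a2)) (M : 'M[R]_a) :
  splits E1 E2 -> E1^T *m M *m E2 = 0 ->
  hurwitz (E1^T *m M *m E1) -> hurwitz (E2^T *m M *m E2) -> hurwitz M.
Proof.
move=> [_ _ _ s1] tri h1 h2.
apply/hurwitz_stable/stable_colP => z x e hz.
have s1c : cplx E1 *m cplx E1^T + cplx E2 *m cplx E2^T = 1%:M.
  by rewrite -!cplxM -cplxD s1 /cplx map_mx1.
have r1 : E1^T *m M = E1^T *m M *m E1 *m E1^T.
  by rewrite -[LHS]mulmx1 -s1 mulmxDr !mulmxA tri mul0mx addr0.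
have x1 : cplx E1^T *m x = 0.
  apply: (stable_col (proj1 (hurwitz_stable _) h1) _ hz).
  by rewrite mulmxA -cplxM -r1 cplxM -mulmxA e scalemxAr.
have ex : x = cplx E2 *m (cplx E2^T *m x).
  by rewrite -[LHS]mul1mx -s1c mulmxDl -!mulmxA x1 mulmx0 add0r.
have x2 : cplx E2^T *m x = 0.
  apply: (stable_col (proj1 (hurwitz_stable _) h2) _ hz).
  by rewrite !cplxM -!mulmxA -ex e scalemxAr.
by rewrite ex x2 mulmx0.
Qed.

(** A block diagonal feedback keeps the closed loop block triangular. *)
Lemma stabilizable_block a a1 a2 b b1 b2 (A : 'M[R]_a) (B : 'M[R]_(a, b))
    (E1 : 'M[R]_(a, a1)) (E2 : 'M[R]_(a, a2)) (D1 : 'M[R]_(b, b1)) (D2 : 'M[R]_(b, b2)) :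
  splits E1 E2 -> E1^T *m A *m E2 = 0 -> E1^T *m B *m D2 = 0 ->
  stabilizable (E1^T *m A *m E1) (E1^T *m B *m D1) ->
  stabilizable (E2^T *m A *m E2) (E2^T *m B *m D2) -> stabilizable A B.
Proof.
move=> sE tA tB [K1 h1] [K2 h2]; have [e11 e22 e12 _] := sE.
have [_ _ e21 _] := splits_sym sE.
exists (D1 *m K1 *m E1^T + D2 *m K2 *m E2^T); apply: (hurwitz_block sE).
- rewrite !(mulmxDr, mulmxDl) !mulmxA tA tB -[_ *m E1^T *m E2]mulmxA e12.
  by rewrite !mulmx0 !mul0mx !addr0.
- rewrite !(mulmxDr, mulmxDl) !mulmxA tB -[_ *m E1^T *m E1]mulmxA e11.
  by rewrite !mul0mx addr0 mulmx1.
- rewrite !(mulmxDr, mulmxDl) !mulmxA -[_ *m E1^T *m E2]mulmxA e12.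
  by rewrite -[_ *m E2^T *m E2]mulmxA e22 mulmx0 add0r mulmx1.
Qed.

(* The output H (u - K x) vanishes only along the closed loop u = K x. *)
Lemma no_zero_restrict a a2 b b2 c (A : 'M[R]_a) (B : 'M[R]_(a, b)) (H : 'M[R]_(c, b))
    (K : 'M[R]_(b, a)) (E : 'M[R]_(a, a2)) (D : 'M[R]_(b, b2))
    (A2 : 'M[R]_a2) (B2 : 'M[R]_(a2, b2)) z :
  row_full H -> hurwitz (A + B *m K) -> E^T *m E = 1%:M ->
  A *m E = E *m A2 -> B *m D = E *m B2 -> 0 <= complex.Re z ->
  no_zero A2 B2 (- (H *m (K *m E))) (H *m D) z.
Proof.
move=> fH hK eE eA eB hz x u e1 e2.
have eu : cplx D *m u = cplx K *m (cplx E *m x).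
  apply/eqP; rewrite -subr_eq0; apply/eqP; apply: (row_full_cplx_inj fH).
  by rewrite -[RHS]e2 cplxN !cplxM mulmxBr mulNmx addrC !mulmxA.
have Ex : cplx E *m x = 0.
  apply: (stable_col (proj1 (hurwitz_stable _) hK) (z := z)); last by rewrite addCJ_ge0E.
  have eA' := congr1 (@cplx R _ _) eA; have eB' := congr1 (@cplx R _ _) eB.
  rewrite !cplxM in eA' eB'.
  rewrite scalemxAr -e1 mulmxDr !mulmxA -eA' -eB' cplxD cplxM !mulmxDl.
  by rewrite -!mulmxA eu.
have -> : x = cplx (E^T *m E) *m x by rewrite eE /cplx map_mx1 mul1mx.
by rewrite cplxM -mulmxA Ex mulmx0.
Qed.

(* With A block lower triangular and B supported on the second block, the Riccati
   equation splits into a Riccati equation for the (2,2) block, linear equations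
   for the off-diagonal block, and a Lyapunov equation for the (1,1) block. *)
Section BlockRiccati.
Variables (a a1 a2 b c : nat) (A : 'M[R]_a) (B : 'M[R]_(a, b)) (F : 'M[R]_(c, a))
  (H : 'M[R]_(c, b)) (E1 : 'M[R]_(a, a1)) (E2 : 'M[R]_(a, a2))
  (A11 : 'M[R]_a1) (A21 : 'M[R]_(a2, a1)) (A22 : 'M[R]_a2) (B2 : 'M[R]_(a2, b))
  (F1 : 'M[R]_(c, a1)) (F2 : 'M[R]_(c, a2)).
Hypotheses (fH : row_full H) (sE : splits E1 E2)
  (AE1 : A *m E1 = E1 *m A11 + E2 *m A21) (AE2 : A *m E2 = E2 *m A22)
  (BE2 : B = E2 *m B2) (FE1 : F *m E1 = F1) (FE2 : F *m E2 = F2).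

Let BtE1 : B^T *m E1 = 0.
Proof.
have [_ _ e _] := splits_sym sE.
by rewrite BE2 trmx_mul -mulmxA e mulmx0.
Qed.

Let BtE2 : B^T *m E2 = B2^T.
Proof. by have [_ e _ _] := sE; rewrite BE2 trmx_mul -mulmxA e mulmx1. Qed.

Let eq_split j (M P : 'M[R]_(j, a)) : M *m E1 = P *m E1 -> M *m E2 = P *m E2 -> M = P.
Proof.
have [_ _ _ s1] := sE.
by move=> q1 q2; rewrite -[M]mulmx1 -[P]mulmx1 -s1 !mulmxDr !mulmxA q1 q2.
Qed.

Lemma AREp_blocks X K : AREp A B F H X K ->
  [/\ AREp A22 B2 F2 H (E2^T *m X *m E2) (K *m E2),
      (K *m E1)^T *m (H^T *m H) + (E1^T *m X *m E2) *m B2 + F1^T *m H = 0 &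
      A11^T *m (E1^T *m X *m E2) + (E1^T *m X *m E2) *m (A22 + B2 *m (K *m E2))
        + A21^T *m (E2^T *m X *m E2) + F1^T *m (F2 + H *m (K *m E2)) = 0].
Proof.
move=> /(AREpE _ _ _ fH) [sX e1 e2].
have eA1 : E1^T *m A^T = A11^T *m E1^T + A21^T *m E2^T.
  by rewrite -trmx_mul AE1 trmxD !trmx_mul.
have eA2 : E2^T *m A^T = A22^T *m E2^T by rewrite -trmx_mul AE2 trmx_mul.
have eAB : (A + B *m K) *m E2 = E2 *m (A22 + B2 *m (K *m E2)).
  by rewrite mulmxDl AE2 mulmxDr {1}BE2 !mulmxA.
have expand j (E : 'M[R]_(a, j)) :
    (E^T *m A^T) *m X *m E2 + E^T *m X *m ((A + B *m K) *m E2)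
    + (F *m E)^T *m (F2 + H *m (K *m E2)) = 0.
  rewrite -[RHS](mul0mx _ E2) -[X in _ = X *m _](mulmx0 _ E^T) -e2.
  by rewrite -FE2 trmx_mul !(mulmxDr, mulmxDl) !mulmxA; mxabel.
have hB : B^T *m E2 *m E2^T = B^T.
  have [_ _ _ s1] := sE.
  by rewrite -[RHS]mulmx1 -s1 mulmxDr !mulmxA BtE1 mul0mx add0r.
split.
- apply/(AREpE _ _ _ fH); split.
  + by rewrite !trmx_mul trmxK sX mulmxA.
  + by rewrite mulmxA e1 mulNmx mulmxDl -[H^T *m F *m E2]mulmxA FE2 -BtE2 !mulmxA hB.
  + by have := expand _ E2; rewrite eA2 eAB FE2 !mulmxA.
- apply: trmx_inj; rewrite trmx0 !trmxD -FE1 !trmx_mul !trmxK sX !mulmxA -BtE2 hB.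
  have := congr1 (mulmx^~ E1) e1; rewrite mulNmx mulmxDl => -> .
  by mxabel.
- have := expand _ E1; rewrite eA1 eAB FE1 !(mulmxDl, mulmxDr) !mulmxA => <-.
  mxabel.
Qed.

(** Converse of [AREp_blocks]. The (2,2) and (1,2) blocks already fix the gain, since [B] has no
    part along [E1]; the (1,1) block is chosen last, from a Lyapunov equation with coefficient
    [A11]. *)
Lemma AREp_assemble (X22 : 'M[R]_a2) (K2 : 'M[R]_(b, a2)) (X12 : 'M[R]_(a1, a2))
    (K1 : 'M[R]_(b, a1)) (K := K1 *m E1^T + K2 *m E2^T) :
  AREp A22 B2 F2 H X22 K2 -> hurwitz A11 -> hurwitz (A22 + B2 *m K2) ->
  K1^T *m (H^T *m H) + X12 *m B2 + F1^T *m H = 0 ->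
  A11^T *m X12 + X12 *m (A22 + B2 *m K2) + A21^T *m X22
    + F1^T *m (F2 + H *m K2) = 0 ->
  exists X, [/\ AREp A B F H X K, psd X & hurwitz (A + B *m K)].
Proof.
move=> /(AREpE _ _ _ fH) [sX22 g22 e22] h1 h2 g12 e12.
have [e11 e22' e120 s1] := sE; have [_ _ e210 _] := splits_sym sE.
have eAB : A + B *m K = E1 *m A11 *m E1^T + E2 *m (A21 + B2 *m K1) *m E1^T
                        + E2 *m (A22 + B2 *m K2) *m E2^T.
  rewrite -[A in LHS]mulmx1 -s1 mulmxDr !mulmxA AE1 AE2 {1}BE2 /K.
  by rewrite !(mulmxDr, mulmxDl) !mulmxA; mxabel.
have [X11 eX11] := sylvester_solvable
  (- (A21^T *m X12^T + X12 *m (A21 + B2 *m K1) + F1^T *m (F1 + H *m K1))) h1 h1.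
have g12K : X12 *m B2 *m K1 + F1^T *m H *m K1 = - (K1^T *m (H^T *m H) *m K1).
  by apply/eqP; rewrite -addr_eq0 -[X in _ == X](mul0mx _ K1) -g12 !mulmxDl addrC addrA.
(* The gain equation makes the right-hand side symmetric, so [X11^T] solves the same Lyapunov
   equation as [X11]. *)
have sX11 : X11^T = X11.
  apply/eqP; rewrite -subr_eq0; apply/eqP; apply: (sylvester_inj h1 h1).
  rewrite mulmxBr mulmxBl.
  have -> : A11^T *m X11^T - A11^T *m X11 + (X11^T *m A11 - X11 *m A11) =
    (A11^T *m X11 + X11 *m A11)^T - (A11^T *m X11 + X11 *m A11).
    by rewrite trmxD !trmx_mul trmxK; mxabel.
  rewrite eX11.
  have -> : A21^T *m X12^T + X12 *m (A21 + B2 *m K1) + F1^T *m (F1 + H *m K1) =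
     A21^T *m X12^T + X12 *m A21 + F1^T *m F1 - K1^T *m (H^T *m H) *m K1.
    by rewrite -g12K !mulmxDr !mulmxA; mxabel.
  by rewrite !(trmxD, trmxN, trmx_mul) !trmxK !mulmxA; mxabel.
pose X := E1 *m X11 *m E1^T + E1 *m X12 *m E2^T + E2 *m X12^T *m E1^T
          + E2 *m X22 *m E2^T.
have sX : X^T = X.
  by rewrite /X !(trmxD, trmx_mul) !trmxK sX11 sX22 !mulmxA; mxabel.
have eX1 : X *m E1 = E1 *m X11 + E2 *m X12^T.
  rewrite /X !mulmxDl -!mulmxA e11 e210 !(mulmx0, mulmx1).
  by mxabel.
have eX2 : X *m E2 = E1 *m X12 + E2 *m X22.
  by rewrite /X !mulmxDl -!mulmxA e22' e120 !(mulmx0, mulmx1); mxabel.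
have eAB1 : (A + B *m K) *m E1 = E1 *m A11 + E2 *m (A21 + B2 *m K1).
  rewrite eAB !mulmxDl -[_ *m E1^T *m E1]mulmxA -[_ *m E1^T *m E1]mulmxA e11.
  by rewrite -[_ *m E2^T *m E1]mulmxA e210 !mulmx0 !mulmx1 addr0.
have eAB2 : (A + B *m K) *m E2 = E2 *m (A22 + B2 *m K2).
  rewrite eAB !mulmxDl -[_ *m E1^T *m E2]mulmxA -[_ *m E1^T *m E2]mulmxA e120.
  by rewrite -[_ *m E2^T *m E2]mulmxA e22' !mulmx0 !mulmx1 !add0r.
have eK1 : K *m E1 = K1.
  by rewrite /K mulmxDl -!mulmxA e11 e210 mulmx0 mulmx1 addr0.
have eK2 : K *m E2 = K2.
  by rewrite /K mulmxDl -!mulmxA e22' e120 mulmx0 mulmx1 add0r.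
clearbody K X.
have gK : H^T *m H *m K = - (B^T *m X + H^T *m F).
  apply: eq_split; rewrite -[_ *m K *m _]mulmxA mulNmx mulmxDl -[B^T *m X *m _]mulmxA.
    rewrite eK1 eX1 -[_ *m F *m E1]mulmxA FE1 mulmxDr !mulmxA BtE1 BtE2 mul0mx add0r.
    apply: trmx_inj; apply/eqP; rewrite trmxN -subr_eq0 opprK -[X in _ == X]g12.
    by rewrite !(trmxD, trmx_mul) !trmxK !mulmxA addrA.
  rewrite eK2 eX2 -[_ *m F *m E2]mulmxA FE2 mulmxDr !mulmxA BtE1 BtE2 mul0mx add0r.
  by rewrite g22.
have hAB : hurwitz (A + B *m K).
  apply: (hurwitz_block sE).
  - by rewrite -mulmxA eAB2 mulmxA e120 mul0mx.
  - by rewrite -mulmxA eAB1 mulmxDr !mulmxA e11 e120 mul0mx addr0 mul1mx.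
  - by rewrite -mulmxA eAB2 mulmxA e22' mul1mx.
pose Z := A^T *m X + X *m (A + B *m K) + F^T *m (F + H *m K).
have expand j k (P : 'M[R]_(a, j)) (Q : 'M[R]_(a, k)) :
    P^T *m Z *m Q = (A *m P)^T *m (X *m Q) + (X *m P)^T *m ((A + B *m K) *m Q)
                    + (F *m P)^T *m (F *m Q + H *m (K *m Q)).
  rewrite /Z !trmx_mul sX !(mulmxDr, mulmxDl) !mulmxA; mxabel.
have r11 k (P : 'M[R]_(a1, k)) : E1^T *m (E1 *m P) = P by rewrite mulmxA e11 mul1mx.
have r22 k (P : 'M[R]_(a2, k)) : E2^T *m (E2 *m P) = P by rewrite mulmxA e22' mul1mx.
have r12 k (P : 'M[R]_(a2, k)) : E1^T *m (E2 *m P) = 0 by rewrite mulmxA e120 mul0mx.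
have r21 k (P : 'M[R]_(a1, k)) : E2^T *m (E1 *m P) = 0 by rewrite mulmxA e210 mul0mx.
have z22 : E2^T *m Z *m E2 = 0.
  rewrite expand AE2 eX2 eAB2 FE2 eK2 -[RHS]e22 !(trmxD, trmx_mul) sX22.
  rewrite !(mulmxDr, mulmxDl) -!mulmxA !(r11, r12, r21, r22) !mulmx0 !mulmxA.
  by mxabel.
have z12 : E1^T *m Z *m E2 = 0.
  rewrite expand AE1 eX1 eX2 eAB2 FE1 FE2 eK2 -[RHS]e12 !(trmxD, trmx_mul) sX11 !trmxK.
  rewrite !(mulmxDr, mulmxDl) -!mulmxA !(r11, r12, r21, r22) !mulmx0 !mulmxA.
  by mxabel.
have z11 : E1^T *m Z *m E1 = 0.
  rewrite expand AE1 eX1 eAB1 FE1 eK1 !(trmxD, trmx_mul) sX11 !trmxK.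
  rewrite !(mulmxDr, mulmxDl) -!mulmxA !(r11, r12, r21, r22) !mulmx0.
  move/eqP: eX11; rewrite -subr_eq0 opprK => /eqP e.
  by rewrite -[RHS]e !(mulmxDr, mulmxDl) !mulmxA; mxabel.
(* The residual is symmetric modulo the gain equation, so its (2,1) block follows from the (1,2)
   block. *)
have sZ : Z^T = Z.
  have kg : K^T *m (H^T *m H *m K + (B^T *m X + H^T *m F)) = 0.
    by rewrite gK addNr mulmx0.
  have gk : (K^T *m (H^T *m H) + (X *m B + F^T *m H)) *m K = 0.
    suff -> : K^T *m (H^T *m H) + (X *m B + F^T *m H) = 0 by rewrite mul0mx.
    by apply: trmx_inj; rewrite trmx0 !(trmxD, trmx_mul) !trmxK sX gK addNr.
  rewrite /Z -[LHS]subr0 -[RHS]subr0 -[X in _ - X = _]kg -[X in _ = _ - X]gk.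
  rewrite !(trmxD, trmx_mul) !trmxK sX.
  by rewrite !(mulmxDr, mulmxDl) !mulmxA; mxabel.
have z21 : E2^T *m Z *m E1 = 0.
  by apply: trmx_inj; rewrite !trmx_mul trmxK sZ trmx0 mulmxA z12.
have are : AREp A B F H X K.
  apply/(AREpE _ _ _ fH); split=> //; rewrite -/Z.
  by apply: eq_split; rewrite mul0mx -[LHS]mul1mx -s1 mulmxDl -!mulmxA
    !(mulmxA _ Z) ?z11 ?z12 ?z21 ?z22 !mulmx0 addr0.
by exists X; split=> //; apply: (AREp_stabilizing_psd fH are).
Qed.

End BlockRiccati.
End Blocks.

(** * Coordinate blocks *)

Lemma thinmx_eq0 (V : nmodType) a b (M : 'M[V]_(a, b)) : b = 0%N -> M = 0.
Proof. by move=> e; subst b; apply: thinmx0. Qed.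

Section Indices.
Variable R : realType.

Lemma idcolsM off off' a b c : (off' + c <= b)%N ->
  idcols R off a b *m idcols R off' b c = idcols R (off + off') a c.
Proof.
move=> h; apply/matrixP => k l; rewrite !mxE.
have hl : (off' + l < b)%N by apply: leq_trans h; rewrite ltn_add2l.
rewrite (bigD1 (Ordinal hl)) //= !mxE eqxx mulr1 addnA big1 ?addr0 // => j hj.
rewrite !mxE; case: (j =P off' + l :> nat)%N => [e|_]; last by rewrite mulr0.
by case/eqP: hj; apply: val_inj.
Qed.

Lemma row_mx_idcols b c : row_mx (idcols R 0 (b + c) b) (idcols R b (b + c) c) = 1%:M.
Proof.
by apply/matrixP => k l; rewrite !mxE; case: splitP => j hj; rewrite mxE -val_eqE /= hj.
Qed.

(** Trades the cast inside [rowcat] for products with coordinate embeddings. *)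
Lemma rowcatE a b b1 b2 (M1 : 'M[R]_(a, b1)) (M2 : 'M[R]_(a, b2)) : b = (b1 + b2)%N ->
  rowcat b M1 M2 = M1 *m (idcols R 0 b b1)^T + M2 *m (idcols R b1 b b2)^T.
Proof.
move=> ->; rewrite /rowcat conform_mx_id -mul_row_col -tr_row_mx row_mx_idcols.
by rewrite trmx1 mulmx1.
Qed.

Lemma colcatE a b b1 b2 (M1 : 'M[R]_(b1, a)) (M2 : 'M[R]_(b2, a)) : b = (b1 + b2)%N ->
  colcat b M1 M2 = idcols R 0 b b1 *m M1 + idcols R b1 b b2 *m M2.
Proof.
by move=> ->; rewrite /colcat conform_mx_id -mul_row_col row_mx_idcols mul1mx.
Qed.

Lemma splits_idcols a b c : a = (b + c)%N -> splits (idcols R 0 a b) (idcols R b a c).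
Proof.
move=> ->; have e := row_mx_idcols b c.
have := congr1 (fun M => M^T *m M) e; rewrite trmx1 mulmx1 tr_row_mx mul_col_row.
rewrite scalar_mx_block => /eq_block_mx [h1 h2 _ h3].
by split=> //; rewrite -mul_row_col -tr_row_mx e trmx1 mulmx1.
Qed.

Lemma dnsz_recl N s i : (i <= N)%N -> dnsz N s i = (s i + dnsz N s i.+1)%N.
Proof. by move=> h; rewrite /dnsz big_ltn. Qed.

Lemma upszS s i : upsz s i.+1 = (upsz s i + s i.+1)%N.
Proof. by rewrite /upsz big_nat_recr. Qed.

Lemma upsz_split N s i : (i <= N)%N -> upsz s N = (upsz s i + dnsz N s i.+1)%N.
Proof. by move=> h; rewrite /upsz /dnsz (@big_cat_nat _ _ _ i.+1). Qed.

Lemma upsz0 s : upsz s 0 = 0%N. Proof. by rewrite /upsz big_geq. Qed.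

Lemma dnsz0 N s : dnsz N s N.+1 = 0%N. Proof. by rewrite /dnsz big_geq. Qed.

Variable N : nat.
Implicit Types s t : nat -> nat.

Lemma splits_Eup_Edn s i : (i <= N)%N -> splits (Eup R N s i) (Edn R N s i.+1).
Proof. by move=> h; apply: splits_idcols; apply: upsz_split. Qed.

Lemma splits_dn s i : (i <= N)%N ->
  splits (idcols R 0 (dnsz N s i) (s i)) (idcols R (s i) (dnsz N s i) (dnsz N s i.+1)).
Proof. by move=> h; apply: splits_idcols; apply: dnsz_recl. Qed.

Lemma splits_up s i :
  splits (idcols R 0 (upsz s i.+1) (upsz s i)) (idcols R (upsz s i) (upsz s i.+1) (s i.+1)).
Proof. exact/splits_idcols/upszS. Qed.

Lemma Edn_idcols0 s i : (i <= N)%N ->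
  Edn R N s i *m idcols R 0 (dnsz N s i) (s i) = Eblk R N s i.
Proof.
by move=> h; rewrite /Edn idcolsM ?addn0 // add0n [leqRHS]dnsz_recl // leq_addr.
Qed.

Lemma Edn_idcols s i : (i < N)%N ->
  Edn R N s i.+1 *m idcols R (s i.+1) (dnsz N s i.+1) (dnsz N s i.+2) = Edn R N s i.+2.
Proof.
move=> h; rewrite /Edn idcolsM /= -?upszS //.
by rewrite [leqRHS]dnsz_recl.
Qed.

Lemma Eup_idcols0 s i :
  Eup R N s i.+1 *m idcols R 0 (upsz s i.+1) (upsz s i) = Eup R N s i.
Proof. by rewrite /Eup idcolsM // add0n upszS leq_addr. Qed.

Lemma Eup_idcols s i :
  Eup R N s i.+1 *m idcols R (upsz s i) (upsz s i.+1) (s i.+1) = Eblk R N s i.+1.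
Proof. by rewrite /Eup idcolsM // -upszS. Qed.

Lemma Edn1 s : Edn R N s 1 = (1%:M : 'M_(upsz s N)).
Proof. by apply/matrixP => k l; rewrite !mxE /= upsz0. Qed.

Lemma EupN s : Eup R N s N = 1%:M.
Proof. by apply/matrixP => k l; rewrite !mxE. Qed.

(** Vanishing single blocks are collected first along the leading rows, then along the trailing
    columns. *)
Lemma lower_block_triangular_up_dn s t (M : 'M[R]_(upsz s N, upsz t N)) i :
  lower_block_triangular M -> (i <= N)%N ->
  (Eup R N s i)^T *m M *m Edn R N t i.+1 = 0.
Proof.
move=> tM hi.
have row_up k j : (j < k <= N)%N -> (Eup R N s j)^T *m (M *m Eblk R N t k) = 0.
  move=> /andP [hj hk]; elim: j hj => [|j ih] hj.
    apply: trmx_inj; rewrite trmx_mul trmxK trmx0.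
    by rewrite (thinmx_eq0 (Eup R N s 0) (upsz0 s)) mulmx0.
  have [_ _ _ s1] := splits_up s j.
  rewrite -[Eup R N s j.+1]mulmx1 -s1 mulmxDr !mulmxA Eup_idcols0 Eup_idcols.
  rewrite trmxD !trmx_mul !trmxK !mulmxDl -!mulmxA ih ?(ltnW hj) // mulmx0 add0r.
  have := tM j.+1 k isT hj hk; rewrite /block -mulmxA => ->.
  by rewrite mulmx0.
(* [d] counts the trailing block columns, so the induction starts from the empty range at [N.+1]. *)
have col_dn d : (i < N.+1 - d)%N -> (d <= N.+1)%N ->
    (Eup R N s i)^T *m M *m Edn R N t (N.+1 - d) = 0.
  elim: d => [|d ih] h1 h2.
    by rewrite subn0 (thinmx_eq0 (Edn R N t N.+1) (dnsz0 N t)) mulmx0.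
  have e : (N.+1 - d = (N.+1 - d.+1).+1)%N by lia.
  move: ih h1; rewrite e; case: (N.+1 - d.+1)%N e => [|k] e ih h1; first by lia.
  have hk : (k < N)%N by lia.
  have [_ _ _ s1] := splits_dn t hk.
  rewrite -[Edn R N t k.+1]mulmx1 -s1 mulmxDr !mulmxA Edn_idcols0 // Edn_idcols //.
  rewrite mulmxDr !mulmxA ih; [|lia|lia].
  rewrite mul0mx addr0 -[_ *m M *m _]mulmxA row_up ?mul0mx //; lia.
have := col_dn (N - i)%N; rewrite subSn ?subKn //; last lia.
by apply; lia.
Qed.

End Indices.

(** * Transposition, and restriction of Riccati equations to invariant coordinate spaces *)

Section Duality.
Variable R : realType.

(** Lets each fact about [AREd] be drawn from its [AREp] version on transposed data. *)
Lemma AREdE a b c (A : 'M[R]_a) (C : 'M[R]_(b, a)) (W : 'M[R]_(a, c))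
    (V : 'M[R]_(b, c)) Y L :
  AREd A C W V Y L <-> AREp A^T C^T W^T V^T Y L^T.
Proof.
have sV : (invmx (V *m V^T))^T = invmx (V *m V^T).
  by rewrite trmx_inv trmx_mul trmxK.
have e : Y^T = Y -> (C *m Y + V *m W^T)^T = Y *m C^T + W *m V^T.
  by move=> sY; rewrite trmxD !trmx_mul trmxK sY.
rewrite /AREd /AREp !trmxK; split=> -[sY e1 e2]; split=> //.
- by rewrite -e // trmxK.
- by rewrite e2 trmxN trmx_mul sV e // trmxK -e // trmxK.
- by rewrite e // -[C *m Y + _]trmxK e.
- apply: trmx_inj; rewrite e2 trmxN trmx_mul sV e //.
Qed.

Lemma detectable_tr a b (C : 'M[R]_(b, a)) (A : 'M[R]_a) :
  detectable C A -> stabilizable A^T C^T.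
Proof.
move=> [L hL]; exists L^T.
by rewrite -trmx_mul -trmxD; apply: hurwitz_tr.
Qed.

Lemma hurwitz_trK a (M : 'M[R]_a) : hurwitz M^T -> hurwitz M.
Proof. by move=> h; rewrite -[M]trmxK; apply: hurwitz_tr. Qed.

Lemma stabilizable_dim0 a b (A : 'M[R]_a) (B : 'M[R]_(a, b)) : a = 0%N -> stabilizable A B.
Proof.
move=> e; subst a; exists 0; apply/hurwitz_stable/stable_colP => z x _ _.
exact: flatmx0.
Qed.

(** One step of the hatted recursion: the output comes from a stabilizing gain, so no zero obstructs
    and stabilizability of the restricted pair suffices. *)
Lemma AREp_restrict a a2 b b2 c (A : 'M[R]_a) (B : 'M[R]_(a, b)) (H : 'M[R]_(c, b))
    (K : 'M[R]_(b, a)) (E : 'M[R]_(a, a2)) (D : 'M[R]_(b, b2))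
    (A2 : 'M[R]_a2) (B2 : 'M[R]_(a2, b2)) :
  row_full H -> hurwitz (A + B *m K) -> E^T *m E = 1%:M -> D^T *m D = 1%:M ->
  A *m E = E *m A2 -> B *m D = E *m B2 -> stabilizable A2 B2 ->
  exists X K2, [/\ AREp A2 B2 (- (H *m (K *m E))) (H *m D) X K2, psd X &
                   hurwitz (A2 + B2 *m K2)].
Proof.
move=> fH hK eE eD eA eB st; have fHD := row_full_mulr fH eD.
have [z hz|X [K2 [h1 h2]]] := AREp_exists fHD st (F := - (H *m (K *m E))).
  by apply: (no_zero_restrict fH hK eE eA eB); rewrite hz.
by exists X, K2; split=> //; apply: (AREp_stabilizing_psd fHD h1 h2).
Qed.

(** Serves uniqueness, where the solution is arbitrary: zeros are excluded in the whole closed right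
    half plane. *)
Lemma AREp_restrict_psd a a2 b b2 c (A : 'M[R]_a) (B : 'M[R]_(a, b)) (H : 'M[R]_(c, b))
    (K : 'M[R]_(b, a)) (E : 'M[R]_(a, a2)) (D : 'M[R]_(b, b2))
    (A2 : 'M[R]_a2) (B2 : 'M[R]_(a2, b2)) X K2 :
  row_full H -> hurwitz (A + B *m K) -> E^T *m E = 1%:M -> D^T *m D = 1%:M ->
  A *m E = E *m A2 -> B *m D = E *m B2 ->
  AREp A2 B2 (- (H *m (K *m E))) (H *m D) X K2 -> psd X -> hurwitz (A2 + B2 *m K2).
Proof.
move=> fH hK eE eD eA eB h pX; have fHD := row_full_mulr fH eD.
apply: (AREp_psd_stabilizing fHD h pX) => z hz.
exact: (no_zero_restrict fH hK eE eA eB hz).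
Qed.

End Duality.

(** * Finite dependent choice along the index range *)

Section Chain.
Variable T : nat -> Type.

(** The types of the unknowns vary with the index. [P] is the invariant carried along, [Q] links
    neighbours, and [d] fills the indices outside the range. *)
Lemma chain_up N (P : forall i, T i -> Prop) (Q : forall i, T i -> T i.+1 -> Prop)
    (d : forall i, T i) (x1 : T 1%N) :
  P 1%N x1 ->
  (forall i x, (1 <= i < N)%N -> P i x -> exists y, P i.+1 y /\ Q i x y) ->
  exists f : forall i, T i, [/\ f 1%N = x1, forall i, (1 <= i <= N)%N -> P i (f i) &
    forall i, (1 <= i < N)%N -> Q i (f i) (f i.+1)].
Proof.
move=> p1; elim: N => [|[|N] ih] step.
- by exists (dfwith d x1); split; [rewrite dfwith_in|lia|lia].
- exists (dfwith d x1); split; [by rewrite dfwith_in| |lia].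
  move=> i hi; have e : i = 1%N by lia.
  by subst i; rewrite dfwith_in.
have [i x hi|f [f1 fP fQ]] := ih; first by apply: step; lia.
have h1 : (1 <= N.+1 < N.+2)%N by rewrite ltnSn.
have h2 : (1 <= N.+1 <= N.+1)%N by rewrite leqnn.
have [y [py qy]] := step N.+1 (f N.+1) h1 (fP N.+1 h2).
exists (dfwith f y); split=> [|i hi|i hi]; first by rewrite dfwith_out.
  by case: dfwithP hi => // j hj hi; apply: fP; lia.
rewrite (dfwith_out _ _ (j := i)); last by lia.
have [e|ne] := eqVneq i N.+1; first by subst i; rewrite dfwith_in.
by rewrite dfwith_out; [apply: fQ|]; lia.
Qed.

Lemma chain_down N (P : forall i, T i -> Prop) (Q : forall i, T i -> T i.+1 -> Prop)
    (d : forall i, T i) (xN : T N) :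
  P N xN ->
  (forall i y, (1 <= i < N)%N -> P i.+1 y -> exists x, P i x /\ Q i x y) ->
  exists f : forall i, T i, [/\ f N = xN, forall i, (1 <= i <= N)%N -> P i (f i) &
    forall i, (1 <= i < N)%N -> Q i (f i) (f i.+1)].
Proof.
move=> pN step.
(* [k] counts the steps taken down from [N]; at [k = N] the lower bound is 0 and the whole range is
   covered. *)
suff /(_ N) [f [fN fP fQ]] : forall k, exists f : forall i, T i, [/\ f N = xN,
    forall i, (1 <= i <= N)%N -> (N - k <= i)%N -> P i (f i) &
    forall i, (1 <= i < N)%N -> (N - k <= i)%N -> Q i (f i) (f i.+1)].
  by exists f; split=> // i hi; [apply: fP|apply: fQ]; rewrite ?subnn.
elim=> [|k [f [fN fP fQ]]].
  exists (dfwith d xN); split=> [|i hi hi'|]; [by rewrite dfwith_in| |lia].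
  have e : i = N by lia.
  by subst i; rewrite dfwith_in.
have [le|lt] := leqP (N - k) 1.
  by exists f; split=> // i hi hi'; [apply: fP|apply: fQ]; lia.
have ek : (N - k = (N - k.+1).+1)%N by lia.
have le := leq_subr k N.
move: (N - k.+1)%N ek lt le fP fQ => j -> lt le fP fQ.
have h1 : (1 <= j < N)%N by lia.
have h2 : (1 <= j.+1 <= N)%N by lia.
have [x [px qx]] := step j (f j.+1) h1 (fP j.+1 h2 (leqnn _)).
exists (dfwith f x); split=> [|i hi hi'|i hi hi'].
- by rewrite dfwith_out //; lia.
- by case: dfwithP hi hi' => // i' ne hi hi'; apply: fP; lia.
- rewrite [dfwith _ _ i.+1]dfwith_out; last by lia.
  have [e|ne] := eqVneq j i; first by subst i; rewrite dfwith_in.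
  by rewrite dfwith_out //; apply: fQ; lia.
Qed.

End Chain.

(** * The decoupled (hatted) equations *)

Section Triangular.
Variables (R : realType) (N : nat) (s t : nat -> nat)
  (M : 'M[R]_(upsz s N, upsz t N)).
Hypothesis tM : lower_block_triangular M.

Lemma Edn_gram (u : nat -> nat) i : (i < N)%N ->
  (Edn R N u i.+1)^T *m Edn R N u i.+1 = 1%:M.
Proof. by move=> hi; have [_ e _ _] := splits_Eup_Edn R u (ltnW hi). Qed.

Lemma Eup_gram (u : nat -> nat) i : (i <= N)%N ->
  (Eup R N u i)^T *m Eup R N u i = 1%:M.
Proof. by move=> hi; have [e _ _ _] := splits_Eup_Edn R u hi. Qed.

Lemma rup_cup_tr i :
  (rup (cup M i) i)^T = (Eup R N t i)^T *m M^T *m Eup R N s i.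
Proof. by rewrite /rup /cup !trmx_mul trmxK. Qed.

(** Lower triangularity as invariance: trailing coordinates are mapped to trailing ones. *)
Lemma mul_Edn i : (i <= N)%N ->
  M *m Edn R N t i.+1 = Edn R N s i.+1 *m rdn (cdn M i.+1) i.+1.
Proof.
move=> hi; have [_ _ _ s1] := splits_Eup_Edn R s hi.
rewrite -[LHS]mul1mx -s1 mulmxDl -!mulmxA (mulmxA _ M).
by rewrite lower_block_triangular_up_dn // mulmx0 add0r.
Qed.

Lemma mul_tr_Eup i : (i <= N)%N ->
  M^T *m Eup R N s i = Eup R N t i *m (rup (cup M i) i)^T.
Proof.
move=> hi; have [_ _ _ s1] := splits_Eup_Edn R t hi.
apply: trmx_inj; rewrite !trmx_mul !trmxK /rup /cup.
rewrite -[LHS]mulmx1 -s1 mulmxDr !mulmxA lower_block_triangular_up_dn //.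
by rewrite mul0mx addr0.
Qed.

(** Supplies the intertwining hypotheses of [AREp_restrict] for passing to the next trailing
    range. *)
Lemma rdn_cdn_step i : (i.+1 < N)%N ->
  rdn (cdn M i.+1) i.+1 *m idcols R (t i.+1) (dnsz N t i.+1) (dnsz N t i.+2) =
  idcols R (s i.+1) (dnsz N s i.+1) (dnsz N s i.+2) *m rdn (cdn M i.+2) i.+2.
Proof.
move=> hi; have hi' := ltnW hi.
rewrite {1}/rdn {1}/cdn -!mulmxA Edn_idcols // mul_Edn // -[in LHS](Edn_idcols _ _ hi').
by rewrite !mulmxA Edn_gram // mul1mx.
Qed.

Lemma rup_cup_step i : (i < N)%N ->
  (rup (cup M i.+1) i.+1)^T *m idcols R 0 (upsz s i.+1) (upsz s i) =
  idcols R 0 (upsz t i.+1) (upsz t i) *m (rup (cup M i) i)^T.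
Proof.
move=> hi; rewrite (rup_cup_tr i.+1) -!mulmxA Eup_idcols0 mul_tr_Eup ?(ltnW hi) //.
by rewrite -[in LHS](Eup_idcols0 R N t i) !mulmxA Eup_gram // mul1mx.
Qed.

End Triangular.

Section Hatted.
Variables (R : realType) (N : nat) (n m p : nat -> nat) (q r : nat).
Variables (A : 'M[R]_(upsz n N, upsz n N)) (B : 'M[R]_(upsz n N, upsz m N))
  (C : 'M[R]_(upsz p N, upsz n N)) (F : 'M[R]_(q, upsz n N)) (H : 'M[R]_(q, upsz m N))
  (W : 'M[R]_(upsz n N, r)) (V : 'M[R]_(upsz p N, r)).
Hypotheses (hN : (1 <= N)%N)
  (hA : lower_block_triangular A) (hB : lower_block_triangular B)
  (hC : lower_block_triangular C) (hyp1 : assumption1 A B C F H W V).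

Lemma row_full_cdn i : (i < N)%N -> row_full (cdn H i.+1).
Proof.
by move=> hi; have [[_ fH] _ _ _] := hyp1; apply: (row_full_mulr fH); apply: Edn_gram.
Qed.

Lemma row_full_trV : row_full V^T.
Proof. by have [_ _ [_ fV] _] := hyp1; rewrite /row_full mxrank_tr. Qed.

Lemma row_full_rup i : (i <= N)%N -> row_full (rup V i)^T.
Proof.
move=> hi; rewrite /rup trmx_mul trmxK; apply: (row_full_mulr row_full_trV).
exact: Eup_gram.
Qed.

(** Downward induction from the empty trailing range: each step puts one diagonal block,
    stabilizable by Assumption 1, before a stabilizable remainder. *)
Lemma stabilizable_dn i : (i <= N)%N ->
  stabilizable (rdn (cdn A i.+1) i.+1) (rdn (cdn B i.+1) i.+1).
Proof.
move=> hi; have -> : i = (N - (N - i))%N by lia.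
move: (N - i)%N (leq_subr i N) => {hi i}; elim=> [|d ih] hd.
  by apply: stabilizable_dim0; rewrite subn0 dnsz0.
have := ih (ltnW hd); have -> : (N - d = (N - d.+1).+1)%N by lia.
have : (N - d.+1 < N)%N by lia.
move: (N - d.+1)%N => i hi {ih hd} st.
have tri t (M : 'M[R]_(upsz n N, upsz t N)) : lower_block_triangular M ->
   (idcols R 0 (dnsz N n i.+1) (n i.+1))^T *m rdn (cdn M i.+1) i.+1
     *m idcols R (t i.+1) (dnsz N t i.+1) (dnsz N t i.+2) = 0.
  move=> tM; rewrite -mulmxA /rdn /cdn -!mulmxA Edn_idcols // !mulmxA -trmx_mul.
  rewrite Edn_idcols0 // -Eup_idcols trmx_mul -!mulmxA (mulmxA _ M).
  by rewrite lower_block_triangular_up_dn // mulmx0.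
have blk t (M : 'M[R]_(upsz n N, upsz t N)) :
   (idcols R 0 (dnsz N n i.+1) (n i.+1))^T *m rdn (cdn M i.+1) i.+1
     *m idcols R 0 (dnsz N t i.+1) (t i.+1) = block M i.+1 i.+1.
  by rewrite /rdn /cdn -!mulmxA !Edn_idcols0 // !mulmxA -trmx_mul Edn_idcols0.
have dn t (M : 'M[R]_(upsz n N, upsz t N)) :
   (idcols R (n i.+1) (dnsz N n i.+1) (dnsz N n i.+2))^T *m rdn (cdn M i.+1) i.+1
     *m idcols R (t i.+1) (dnsz N t i.+1) (dnsz N t i.+2) = rdn (cdn M i.+2) i.+2.
  by rewrite /rdn /cdn -!mulmxA !Edn_idcols // !mulmxA -trmx_mul Edn_idcols // -mulmxA.
apply: (stabilizable_block (D1 := idcols R 0 (dnsz N m i.+1) (m i.+1))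
  (splits_dn R n hi) (tri _ _ hA) (tri _ _ hB)).
  by rewrite (blk _ A) (blk _ B); have [[st0 _] _ _ _] := hyp1; apply: st0.
by rewrite (dn _ A) (dn _ B).
Qed.

Lemma stabilizable_tr_up i : (i <= N)%N ->
  stabilizable (rup (cup A i) i)^T (rup (cup C i) i)^T.
Proof.
elim: i => [|i ih] hi; first by apply: stabilizable_dim0; rewrite upsz0.
have tri t (M : 'M[R]_(upsz t N, upsz n N)) : lower_block_triangular M ->
   (idcols R (upsz n i) (upsz n i.+1) (n i.+1))^T *m (rup (cup M i.+1) i.+1)^T
     *m idcols R 0 (upsz t i.+1) (upsz t i) = 0.
  move=> tM; rewrite rup_cup_tr !mulmxA -trmx_mul Eup_idcols.
  rewrite -mulmxA Eup_idcols0 -(Edn_idcols0 _ _ hi).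
  apply: trmx_inj; rewrite !trmx_mul !trmxK trmx0 !mulmxA.
  by rewrite lower_block_triangular_up_dn ?mul0mx // ltnW.
have blk t (M : 'M[R]_(upsz t N, upsz n N)) :
   (idcols R (upsz n i) (upsz n i.+1) (n i.+1))^T *m (rup (cup M i.+1) i.+1)^T
     *m idcols R (upsz t i) (upsz t i.+1) (t i.+1) = (block M i.+1 i.+1)^T.
  rewrite rup_cup_tr !mulmxA -trmx_mul Eup_idcols.
  by rewrite -mulmxA Eup_idcols /block !trmx_mul trmxK !mulmxA.
have up t (M : 'M[R]_(upsz t N, upsz n N)) :
   (idcols R 0 (upsz n i.+1) (upsz n i))^T *m (rup (cup M i.+1) i.+1)^T
     *m idcols R 0 (upsz t i.+1) (upsz t i) = (rup (cup M i) i)^T.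
  rewrite rup_cup_tr !mulmxA -trmx_mul Eup_idcols0.
  by rewrite -mulmxA Eup_idcols0 rup_cup_tr.
apply: (stabilizable_block (D1 := idcols R (upsz p i) (upsz p i.+1) (p i.+1))
  (splits_sym (splits_up R n i)) (tri _ _ hA) (tri _ _ hC)).
  by rewrite (blk _ A) (blk _ C); have [_ _ [dt _] _] := hyp1; apply/detectable_tr/dt.
by rewrite (up _ A) (up _ C); apply/ih/ltnW.
Qed.

Lemma AhK1 (K : 'M[R]_(upsz m N, upsz n N)) :
  rdn (cdn A 1) 1 + rdn (cdn B 1) 1 *m K = A + B *m K.
Proof. by rewrite /rdn /cdn !Edn1 trmx1 !mul1mx !mulmx1. Qed.

Lemma AhLN (L : 'M[R]_(upsz n N, upsz p N)) :
  rup (cup A N) N + L *m rup (cup C N) N = A + L *m C.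
Proof. by rewrite /rup /cup !EupN !trmx1 !mul1mx !mulmx1. Qed.

Lemma AREp_first : exists X K, [/\ AREp A B F H X K, psd X & hurwitz (A + B *m K)].
Proof.
have [[_ fH] z1 _ _] := hyp1.
have st : stabilizable A B.
  by have := stabilizable_dn (leq0n N); rewrite /rdn /cdn !Edn1 trmx1 !mul1mx !mulmx1.
have [[x y] /= ->|X [K [h1 h2]]] := AREp_exists fH st (F := F).
  exact: no_zero_pencil.
by exists X, K; split=> //; apply: (AREp_stabilizing_psd fH h1 h2).
Qed.

Lemma AREd_last : exists Y L, [/\ AREd A C W V Y L, psd Y & hurwitz (A + L *m C)].
Proof.
have [_ _ _ z2] := hyp1.
have st : stabilizable A^T C^T.
  by have := stabilizable_tr_up (leqnn N); rewrite /rup /cup !EupN !trmx1 !mul1mx !mulmx1.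
have [[x y] /= ->|Y [K [h1 h2]]] := AREp_exists row_full_trV st (F := W^T).
  apply: no_zero_pencil.
  (* The dual rank condition is the primal one for the transposed pencil. *)
  have := z2 y; rewrite -row_leq_rank -mxrank_tr => h.
  rewrite -col_leq_rank (leq_trans h) // tr_block_mx.
  by rewrite trmxD trmxN tr_scalar_mx !cplx_tr.
exists Y, K^T; split.
- by apply/AREdE; rewrite trmxK.
- exact: (AREp_stabilizing_psd row_full_trV h1 h2).
- by apply: hurwitz_trK; rewrite trmxD trmx_mul trmxK; exact: h2.
Qed.

Lemma hatted_exists : exists Xh Kh Yh Lh, hatted A B C F H W V Xh Kh Yh Lh.
Proof.
have [X1 [K1 [x1 x2 x3]]] := AREp_first.
have [YN [LN [y1 y2 y3]]] := AREd_last.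
pose TX i : Type := ('M[R]_(dnsz N n i) * 'M[R]_(dnsz N m i, dnsz N n i))%type.
pose TY i : Type := ('M[R]_(upsz n i) * 'M[R]_(upsz n i, upsz p i))%type.
(* The invariant keeps each gain stabilizing, which is what excludes zeros at the next step. *)
have [||XK [f1 fP fQ]] := @chain_up TX N
  (fun i x => psd x.1 /\ hurwitz (rdn (cdn A i) i + rdn (cdn B i) i *m x.2))
  (fun i x y => AREp (rdn (cdn A i.+1) i.+1) (rdn (cdn B i.+1) i.+1)
                (- (cdn H i *m (x.2 *m idcols R (n i) _ _))) (cdn H i.+1) y.1 y.2)
  (fun i => (0, 0)) (X1, K1).
- by rewrite -AhK1 in x3; exact: (conj x2 x3).
- move=> [//|i] [X K] /= hi [pX hK].
  have hi' := ltnW hi.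
  have [||Y [L [h1 h2 h3]]] := AREp_restrict (row_full_cdn hi') hK _ _
     (rdn_cdn_step hA hi) (rdn_cdn_step hB hi) (stabilizable_dn hi').
  + by have [_ e _ _] := splits_dn R n hi'.
  + by have [_ e _ _] := splits_dn R m hi'.
  have eH : cdn H i.+2 = cdn H i.+1 *m idcols R (m i.+1) _ _.
    by rewrite /cdn -mulmxA Edn_idcols.
  by exists (Y, L); split; [exact: (conj h2 h3) | rewrite eH; exact: h1].
have [||YL [gN gP gQ]] := @chain_down TY N
  (fun i x => psd x.1 /\ hurwitz (rup (cup A i) i + x.2 *m rup (cup C i) i))
  (fun i x y => AREd (rup (cup A i) i) (rup (cup C i) i)
      (- ((idcols R 0 _ _)^T *m y.2 *m rup V i.+1)) (rup V i) x.1 x.2)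
  (fun i => (0, 0)) (YN, LN).
- by rewrite -AhLN in y3; exact: (conj y2 y3).
- move=> i [Y L] /= /andP [_ hi] [pY hL].
  have hL' : hurwitz ((rup (cup A i.+1) i.+1)^T + (rup (cup C i.+1) i.+1)^T *m L^T).
    by rewrite -trmx_mul -trmxD; apply: hurwitz_tr.
  have [||X [K [h1 h2 h3]]] := AREp_restrict (row_full_rup hi) hL' _ _
     (rup_cup_step hA hi) (rup_cup_step hC hi) (stabilizable_tr_up (ltnW hi)).
  + by have [e _ _ _] := splits_up R n i.
  + by have [e _ _ _] := splits_up R p i.
  have e1 : (- ((idcols R 0 (upsz n i.+1) (upsz n i))^T *m L *m rup V i.+1))^T =
      - ((rup V i.+1)^T *m (L^T *m idcols R 0 (upsz n i.+1) (upsz n i))).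
    by rewrite trmxN (trmx_mul _ (rup V _)) (trmx_mul _ L) trmxK.
  have e2 : (rup V i)^T = (rup V i.+1)^T *m idcols R 0 (upsz p i.+1) (upsz p i).
    by rewrite /rup !trmx_mul !trmxK -mulmxA Eup_idcols0.
  have h4 : hurwitz (rup (cup A i) i + K^T *m rup (cup C i) i).
    by apply: hurwitz_trK; rewrite trmxD (trmx_mul K^T) trmxK; exact: h3.
  exists (X, K^T); split; first exact: (conj h2 h4).
  by apply/AREdE; rewrite e1 e2 trmxK; exact: h1.
exists (fun i => (XK i).1), (fun i => (XK i).2), (fun i => (YL i).1), (fun i => (YL i).2).
split.
- by rewrite f1; exact: (conj x1 fQ).
- by rewrite gN; exact: (conj y1 gQ).
- by move=> i hi; exact: (conj (proj1 (fP i hi)) (proj1 (gP i hi))).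
- by move=> i hi; exact: (conj (proj2 (fP i hi)) (proj2 (gP i hi))).
Qed.

End Hatted.

(** * The coupled equations *)

Section Overlaps.
Variables (R : realType) (N : nat) (s : nat -> nat) (i : nat).
Hypothesis hi : (i < N)%N.

Lemma Eup_EupS : (Eup R N s i)^T *m Eup R N s i.+1 = (idcols R 0 (upsz s i.+1) (upsz s i))^T.
Proof.
by rewrite -(Eup_idcols0 R N s i) trmx_mul -mulmxA Eup_gram // mulmx1.
Qed.

Lemma Edn_EdnS : (Edn R N s i.+1)^T *m Edn R N s i.+2 =
  idcols R (s i.+1) (dnsz N s i.+1) (dnsz N s i.+2).
Proof. by rewrite -(Edn_idcols R s hi) mulmxA Edn_gram // mul1mx. Qed.

Lemma Eup_Edn : (Eup R N s i)^T *m Edn R N s i.+1 = 0.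
Proof. by have [_ _ e _] := splits_Eup_Edn R s (ltnW hi). Qed.

Lemma Edn_Eup : (Edn R N s i.+1)^T *m Eup R N s i = 0.
Proof. by have [_ _ e _] := splits_sym (splits_Eup_Edn R s (ltnW hi)). Qed.

Lemma Eup_EdnS : (Eup R N s i)^T *m Edn R N s i.+2 = 0.
Proof. by rewrite -(Edn_idcols R s hi) mulmxA Eup_Edn mul0mx. Qed.

(** The two ranges overlap in block [i.+1] only. *)
Lemma Edn_EupS : (Edn R N s i.+1)^T *m Eup R N s i.+1 =
  idcols R 0 (dnsz N s i.+1) (s i.+1) *m (idcols R (upsz s i) (upsz s i.+1) (s i.+1))^T.
Proof.
have [_ _ _ s1] := splits_up R s i.
rewrite -[LHS]mulmx1 -s1 mulmxDr -!mulmxA (mulmxA (Eup R N s i.+1)).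
rewrite (mulmxA (Eup R N s i.+1) (idcols R (upsz s i) _ _)) Eup_idcols0 Eup_idcols.
rewrite !(mulmxA (Edn R N s i.+1)^T) Edn_Eup mul0mx add0r -(Edn_idcols0 R s hi).
by rewrite !mulmxA Edn_gram // mul1mx.
Qed.

End Overlaps.

Section Coupled.
Variables (R : realType) (N : nat) (n m p : nat -> nat) (q r : nat).
Variables (A : 'M[R]_(upsz n N, upsz n N)) (B : 'M[R]_(upsz n N, upsz m N))
  (C : 'M[R]_(upsz p N, upsz n N)) (F : 'M[R]_(q, upsz n N)) (H : 'M[R]_(q, upsz m N))
  (W : 'M[R]_(upsz n N, r)) (V : 'M[R]_(upsz p N, r)).
Hypotheses (hN : (1 <= N)%N)
  (hA : lower_block_triangular A) (hB : lower_block_triangular B)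
  (hC : lower_block_triangular C) (hyp1 : assumption1 A B C F H W V).

Lemma rdn_cdn_Psi j k : rdn (cdn (Psi H) j) k = (cdn H k)^T *m cdn H j.
Proof. by rewrite /rdn /cdn /Psi trmx_mul !mulmxA. Qed.

Lemma rup_cup_Phi j k : rup (cup (Phi V) j) k = rup V k *m (rup V j)^T.
Proof. by rewrite /rup /cup /Phi trmx_mul trmxK !mulmxA. Qed.

Section Gains.
Variables (Kh : forall i, 'M[R]_(dnsz N m i, dnsz N n i))
  (Lh : forall i, 'M[R]_(upsz n i, upsz p i))
  (Kb : forall i, 'M[R]_(dnsz N m i, upsz n i.-1))
  (Lb : forall i, 'M[R]_(dnsz N n i.+1, upsz p i)).

(** The coupled gain recomposed: barred part on the leading coordinates, hatted part on the trailing
    ones. The barred part is empty at [i = 1], and at [i = N] for [Lfull]. *)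
Definition Kfull i : 'M[R]_(dnsz N m i, upsz n N) :=
  Kb i *m (Eup R N n i.-1)^T + Kh i *m (Edn R N n i)^T.
Definition Lfull i : 'M[R]_(upsz n N, upsz p i) :=
  Eup R N n i *m Lh i + Edn R N n i.+1 *m Lb i.

(** Origin of [rowK] in Assumption 2: moving the cut one block further shifts the first block column
    of the hatted gain to the leading side. *)
Lemma Kfull_Eup i : (i < N)%N -> Kfull i.+1 *m Eup R N n i.+1 = Defs.rowK Kh Kb i.+1.
Proof.
move=> hi; rewrite /Kfull /Defs.rowK rowcatE; last exact: upszS.
by rewrite mulmxDl -!mulmxA Eup_EupS // Edn_EupS // /Kha mulmxA.
Qed.

Lemma Kfull_Edn i : (i < N)%N -> Kfull i.+1 *m Edn R N n i.+2 = Khb Kh i.+1.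
Proof.
move=> hi; rewrite /Kfull mulmxDl -!mulmxA Eup_EdnS // mulmx0 add0r Edn_EdnS //.
Qed.

Lemma Edn_Lfull i : (i < N)%N -> (Edn R N n i.+1)^T *m Lfull i.+1 = colL Lh Lb i.+1.
Proof.
move=> hi; rewrite /Lfull /colL colcatE; last exact: dnsz_recl.
by rewrite mulmxDr !mulmxA Edn_EupS // Edn_EdnS // /Lha -!mulmxA.
Qed.

Lemma Eup_Lfull i : (i < N)%N -> (Eup R N n i)^T *m Lfull i.+1 = Lhb Lh i.+1.
Proof.
by move=> hi; rewrite /Lfull mulmxDr !mulmxA Eup_EupS // Eup_EdnS // mul0mx addr0.
Qed.

Lemma Kfull1 : Kfull 1 = Kh 1%N.
Proof.
rewrite /Kfull (thinmx_eq0 (Eup R N n 1.-1) (upsz0 n)) trmx0 mulmx0 add0r.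
by rewrite Edn1 trmx1 mulmx1.
Qed.

Lemma LfullN : Lfull N = Lh N.
Proof.
rewrite /Lfull (thinmx_eq0 (Edn R N n N.+1) (dnsz0 N n)) mul0mx addr0.
by rewrite EupN mul1mx.
Qed.

Variable i : nat.
Hypothesis hi : (i < N)%N.
Let hi' := ltnW hi.
Let sE := splits_Eup_Edn R n hi'.

Lemma rupC_Edn : rup C i *m Edn R N n i.+1 = 0.
Proof. by rewrite /rup lower_block_triangular_up_dn. Qed.

(** Output injection acts through leading columns only: it produces [AhL] and [AbL] there, and
    leaves the trailing block columns of [A] unchanged. *)
Lemma open_loop_Eup : (A + Lfull i *m rup C i) *m Eup R N n i =
  Eup R N n i *m AhL A C Lh i + Edn R N n i.+1 *m AbL A C Lb i.
Proof.
have [_ _ _ s1] := sE.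
have eA : A *m Eup R N n i = Eup R N n i *m ((Eup R N n i)^T *m (A *m Eup R N n i))
    + Edn R N n i.+1 *m ((Edn R N n i.+1)^T *m (A *m Eup R N n i)).
  by rewrite !mulmxA -!mulmxDl s1 mul1mx.
rewrite mulmxDl eA /AhL /AbL /Lfull /rup /cup /rdn.
by rewrite !(mulmxDl, mulmxDr) !mulmxA; mxabel.
Qed.

Lemma open_loop_Edn : (A + Lfull i *m rup C i) *m Edn R N n i.+1 =
  Edn R N n i.+1 *m rdn (cdn A i.+1) i.+1.
Proof. by rewrite mulmxDl -[_ *m rup C i *m _]mulmxA rupC_Edn mulmx0 addr0 mul_Edn. Qed.

(** For transposed data the two coordinate spaces exchange roles: the leading one is invariant and
    carries [(rup C i)^T]. *)
Lemma open_loop_tr_Edn : (A + cdn B i.+1 *m Kfull i.+1)^T *m Edn R N n i.+1 =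
  Edn R N n i.+1 *m (AhK A B Kh i.+1)^T + Eup R N n i *m (AbK A B Kb i.+1)^T.
Proof.
have [_ e22 e12 s1] := sE.
apply: trmx_inj.
rewrite (trmx_mul _ (Edn R N n i.+1)) trmxK trmxD (trmx_mul (Edn R N n i.+1)).
rewrite (trmx_mul (Eup R N n i)) !trmxK.
have eA : (Edn R N n i.+1)^T *m A =
    (Edn R N n i.+1)^T *m (A *m Eup R N n i) *m (Eup R N n i)^T
    + (Edn R N n i.+1)^T *m (A *m Edn R N n i.+1) *m (Edn R N n i.+1)^T.
  by rewrite -[LHS]mulmx1 -s1 mulmxDr !mulmxA.
rewrite mulmxDr eA /AhK /AbK /Kfull /cup /cdn /rdn /=.
by rewrite !(mulmxDl, mulmxDr) !mulmxA; mxabel.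
Qed.

Lemma open_loop_tr_Eup : (A + cdn B i.+1 *m Kfull i.+1)^T *m Eup R N n i =
  Eup R N n i *m (rup (cup A i) i)^T.
Proof.
rewrite trmxD mulmxDl mul_tr_Eup // (trmx_mul (cdn B _)) -mulmxA.
have -> : (cdn B i.+1)^T *m Eup R N n i = 0.
  rewrite /cdn; apply: trmx_inj; rewrite trmx_mul trmx0 trmxK mulmxA.
  exact: lower_block_triangular_up_dn.
by rewrite mulmx0 addr0.
Qed.

Lemma rupC_tr : (rup C i)^T = Eup R N n i *m (rup (cup C i) i)^T.
Proof. by rewrite -mul_tr_Eup // /rup trmx_mul trmxK. Qed.

Lemma trmx_mulr a b c (P : 'M[R]_(a, b)) (E : 'M[R]_(a, c)) : P^T *m E = (E^T *m P)^T.
Proof. by rewrite trmx_mul trmxK. Qed.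

Lemma weightV_Edn : (- (Lfull i.+1 *m rup V i.+1))^T *m Edn R N n i.+1 =
  (- (colL Lh Lb i.+1 *m rup V i.+1))^T.
Proof. by rewrite trmx_mulr mulmxN mulmxA Edn_Lfull. Qed.

Lemma weightV_Eup : (- (Lfull i.+1 *m rup V i.+1))^T *m Eup R N n i =
  (- (Lhb Lh i.+1 *m rup V i.+1))^T.
Proof. by rewrite trmx_mulr mulmxN mulmxA Eup_Lfull. Qed.

Lemma weightH_Eup : - (cdn H i.+1 *m Kfull i.+1) *m Eup R N n i.+1 =
  - (cdn H i.+1 *m Defs.rowK Kh Kb i.+1).
Proof. by rewrite mulNmx -mulmxA Kfull_Eup. Qed.

Lemma weightH_Edn : - (cdn H i.+1 *m Kfull i.+1) *m Edn R N n i.+2 =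
  - (cdn H i.+1 *m Khb Kh i.+1).
Proof. by rewrite mulNmx -mulmxA Kfull_Edn. Qed.

End Gains.

Section LinearEquations.
Variables (Xh : forall i, 'M[R]_(dnsz N n i)) (Kh : forall i, 'M[R]_(dnsz N m i, dnsz N n i))
  (Yh : forall i, 'M[R]_(upsz n i)) (Lh : forall i, 'M[R]_(upsz n i, upsz p i))
  (Xb : forall i, 'M[R]_(upsz n i.-1, dnsz N n i))
  (Kb : forall i, 'M[R]_(dnsz N m i, upsz n i.-1))
  (Yb : forall i, 'M[R]_(upsz n i, dnsz N n i.+1))
  (Lb : forall i, 'M[R]_(dnsz N n i.+1, upsz p i)).

(** Matches Assumption 2 with the off-diagonal equations of [AREp_blocks], by expanding [Psi] as
    [H^T H]. *)
Lemma linear_system_XE i (rK := Defs.rowK Kh Kb i) :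
  ((Kb i.+1)^T *m rdn (cdn (Psi H) i.+1) i.+1 + Xb i.+1 *m rdn (cdn B i.+1) i.+1
     - rK^T *m rdn (cdn (Psi H) i.+1) i =
   (Kb i.+1)^T *m ((cdn H i.+1)^T *m cdn H i.+1) + Xb i.+1 *m rdn (cdn B i.+1) i.+1
     + (- (cdn H i *m rK))^T *m cdn H i.+1) *
  ((AhL A C Lh i)^T *m Xb i.+1 + Xb i.+1 *m AhK A B Kh i.+1 + (AbL A C Lb i)^T *m Xh i.+1
     + rK^T *m (rdn (cdn (Psi H) i) i *m Khb Kh i - rdn (cdn (Psi H) i.+1) i *m Kh i.+1) =
   (AhL A C Lh i)^T *m Xb i.+1 + Xb i.+1 *m AhK A B Kh i.+1 + (AbL A C Lb i)^T *m Xh i.+1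
     + (- (cdn H i *m rK))^T *m (- (cdn H i *m Khb Kh i) + cdn H i.+1 *m Kh i.+1)).
Proof.
rewrite !rdn_cdn_Psi; move: (cdn H i) (cdn H i.+1) (rdn (cdn B i.+1) i.+1) => v w c.
move: rK (AhK _ _ _ _) (AhL _ _ _ _) (AbL _ _ _ _) (Khb _ _) => rK a1 a2 a3 kb.
split; rewrite !(trmxN, trmx_mul, trmxK, mulmxDl, mulmxDr, mulNmx, mulmxN, mulmxA).
  by mxabel.
by mxabel.
Qed.

(** The off-diagonal unknown of the transposed problem is [(Yb i)^T]; hence the outer transposes. *)
Lemma linear_system_YE i (cL := colL Lh Lb i.+1) :
  (rup (cup (Phi V) i) i *m (Lb i)^T + rup (cup C i) i *m Yb i
     - rup (cup (Phi V) i.+1) i *m cL^T =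
   ((Lb i)^T^T *m (((rup V i)^T)^T *m (rup V i)^T) + (Yb i)^T *m (rup (cup C i) i)^T
     + (- (cL *m rup V i.+1))^T^T *m (rup V i)^T)^T) *
  (AhL A C Lh i *m Yb i + Yb i *m (AhK A B Kh i.+1)^T + Yh i *m (AbK A B Kb i.+1)^T
     + (Lhb Lh i.+1 *m rup (cup (Phi V) i.+1) i.+1
        - Lh i *m rup (cup (Phi V) i.+1) i) *m cL^T =
   ((AhK A B Kh i.+1)^T^T *m (Yb i)^T + (Yb i)^T *m (AhL A C Lh i)^T
     + (AbK A B Kb i.+1)^T^T *m (Yh i)^T
     + (- (cL *m rup V i.+1))^T^T *m
       ((- (Lhb Lh i.+1 *m rup V i.+1))^T + (rup V i)^T *m (Lh i)^T))^T).
Proof.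
rewrite !rup_cup_Phi !trmxK; move: (rup V i) (rup V i.+1) (rup (cup C i) i) => v w c.
move: cL (AhK _ _ _ _) (AbK _ _ _ _) (AhL _ _ _ _) (Lhb _ _) => cL a1 a2 a3 lb.
split; rewrite !(trmxD, trmxN, trmx_mul, trmxK, mulmxDl, mulmxDr, mulNmx, mulmxN, mulmxA).
  by mxabel.
by mxabel.
Qed.

End LinearEquations.
End Coupled.

Lemma psd_congr (R : realType) a b (X : 'M[R]_a) (E : 'M[R]_(a, b)) :
  psd X -> psd (E^T *m X *m E).
Proof.
move=> [sX pX]; split=> [|v]; first by rewrite !trmx_mul trmxK sX mulmxA.
by have := pX (E *m v); rewrite trmx_mul !mulmxA.
Qed.

(** * Existence: assembling coupled solutions from hatted and barred quantities *)

Section Solutions.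
Variables (R : realType) (N : nat) (n m p : nat -> nat) (q r : nat).
Variables (A : 'M[R]_(upsz n N, upsz n N)) (B : 'M[R]_(upsz n N, upsz m N))
  (C : 'M[R]_(upsz p N, upsz n N)) (F : 'M[R]_(q, upsz n N)) (H : 'M[R]_(q, upsz m N))
  (W : 'M[R]_(upsz n N, r)) (V : 'M[R]_(upsz p N, r)).
Hypotheses (hN : (1 <= N)%N)
  (hA : lower_block_triangular A) (hB : lower_block_triangular B)
  (hC : lower_block_triangular C) (hyp1 : assumption1 A B C F H W V).
Variables (Xh : forall i, 'M[R]_(dnsz N n i)) (Kh : forall i, 'M[R]_(dnsz N m i, dnsz N n i))
  (Yh : forall i, 'M[R]_(upsz n i)) (Lh : forall i, 'M[R]_(upsz n i, upsz p i))
  (Xb : forall i, 'M[R]_(upsz n i.-1, dnsz N n i))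
  (Kb : forall i, 'M[R]_(dnsz N m i, upsz n i.-1))
  (Yb : forall i, 'M[R]_(upsz n i, dnsz N n i.+1))
  (Lb : forall i, 'M[R]_(dnsz N n i.+1, upsz p i)).

Let K := Kfull Kh Kb.
Let L := Lfull Lh Lb.

Lemma AhL_tr i : (AhL A C Lh i)^T =
  (rup (cup A i) i)^T + (rup (cup C i) i)^T *m (Lh i)^T.
Proof. by rewrite /AhL trmxD (trmx_mul (Lh i)). Qed.

(** The index is written [j.+2] so that the predecessors in the types of [Xb] and [Kb] reduce by
    conversion. *)
Lemma coupled_X_exists j : (j.+1 < N)%N ->
  hatted A B C F H W V Xh Kh Yh Lh ->
  linear_system A B C H V Xh Kh Yh Lh Xb Kb Yb Lb ->
  exists X, [/\ AREp (A + L j.+1 *m rup C j.+1) (cdn B j.+2)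
                  (- (cdn H j.+1 *m K j.+1)) (cdn H j.+2) X (K j.+2), psd X &
                hurwitz (A + L j.+1 *m rup C j.+1 + cdn B j.+2 *m K j.+2)].
Proof.
move=> hj [[_ xs] _ _ hur] /(_ j.+1 hj) [l1 l2 _ _].
have [e1 e2] := linear_system_XE A B C H Xh Kh Lh Xb Kb Lb j.+1.
have hj' := ltnW hj.
apply: (AREp_assemble (row_full_cdn hyp1 hj) (splits_Eup_Edn R n hj')
  (open_loop_Eup A C Lh Lb hj) (open_loop_Edn hA hC Lh Lb hj) (mul_Edn hB hj')
  (weightH_Eup H Kh Kb hj') (weightH_Edn H Kh Kb hj') (xs j.+1 hj)
  (X12 := Xb j.+2) (K1 := Kb j.+2)).
- by have [|_ h] := hur j.+1; [exact: hj' | exact: h].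
- by have [|h _] := hur j.+2; [exact: hj | exact: h].
- by rewrite -e1; exact: l1.
- by rewrite -e2; exact: l2.
Qed.

(** Stability is left to the equation for [X i.+1], whose closed loop matrix is the same. *)
Lemma coupled_Y_exists i : (1 <= i < N)%N ->
  hatted A B C F H W V Xh Kh Yh Lh ->
  linear_system A B C H V Xh Kh Yh Lh Xb Kb Yb Lb ->
  exists Y, AREd (A + cdn B i.+1 *m K i.+1) (rup C i)
              (- (L i.+1 *m rup V i.+1)) (rup V i) Y (L i) /\ psd Y.
Proof.
move=> hi0 [_ [_ ys] hpsd hur] /(_ i hi0) [_ _ l3 l4].
have /andP [i1 hi] := hi0; have hi' := ltnW hi.
have [e3 e4] := linear_system_YE A B C V Kh Yh Lh Kb Yb Lb i.
have sY : (Yh i)^T = Yh i.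
  by have [|_ [h _]] := hpsd i; [rewrite i1 hi' | exact: h].
have [||||Y [h1 h2 _]] := AREp_assemble (row_full_rup hyp1 hi')
  (splits_sym (splits_Eup_Edn R n hi')) (open_loop_tr_Edn A B Kh Kb hi)
  (open_loop_tr_Eup hA hB Kh Kb hi) (rupC_tr hC hi)
  (weightV_Edn V Lh Lb hi) (weightV_Eup V Lh Lb hi) (proj1 (AREdE _ _ _ _ _ _) (ys i hi0))
  (X12 := (Yb i)^T) (K1 := (Lb i)^T).
- by have [|h _] := hur i.+1; [exact: hi | apply: hurwitz_tr; exact: h].
- rewrite -AhL_tr; apply: hurwitz_tr.
  by have [|_ h] := hur i; [rewrite i1 hi' | exact: h].
- by apply: trmx_inj; rewrite -e3 trmx0; exact: l3.
- apply: trmx_inj; rewrite -AhL_tr -{1}sY -e4 trmx0; exact: l4.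
exists Y; split=> //; apply/AREdE.
have -> : (L i)^T = (Lb i)^T *m (Edn R N n i.+1)^T + (Lh i)^T *m (Eup R N n i)^T.
  by rewrite /L /Lfull trmxD !trmx_mul addrC.
exact: h1.
Qed.

Lemma coupled_exists :
  hatted A B C F H W V Xh Kh Yh Lh ->
  linear_system A B C H V Xh Kh Yh Lh Xb Kb Yb Lb ->
  exists X Y, [/\ coupled_AREs A B C F H W V X K Y L, coupled_psd X Y &
                  coupled_stabilizing A B C K L].
Proof.
move=> hh hl; have [[x1 _] [yN _] hpsd hur] := hh.
have [p1 _] : psd (Xh 1%N) /\ psd (Yh 1%N) by apply: hpsd; rewrite leqnn.
have [_ pN] : psd (Xh N) /\ psd (Yh N) by apply: hpsd; rewrite hN leqnn.
have [h1 _] : hurwitz (AhK A B Kh 1) /\ hurwitz (AhL A C Lh 1).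
  by apply: hur; rewrite leqnn.
have [_ hNN] : hurwitz (AhK A B Kh N) /\ hurwitz (AhL A C Lh N).
  by apply: hur; rewrite hN leqnn.
(* The chain lemma serves only to choose: the equation for [X i.+1] involves gains but no other
   [X]. *)
have [||X [eX1 _ hX]] := @chain_up (fun=> 'M[R]_(upsz n N)) N (fun _ _ => True)
  (fun i _ X => [/\ AREp (A + L i *m rup C i) (cdn B i.+1)
                  (- (cdn H i *m K i)) (cdn H i.+1) X (K i.+1), psd X &
                hurwitz (A + L i *m rup C i + cdn B i.+1 *m K i.+1)])
  (fun=> 0) (Xh 1%N).
- by [].
- move=> [//|j] x /andP [_ hj] _.
  by have [y hy] := coupled_X_exists hj hh hl; exists y.
have [||Y [eYN _ hY]] := @chain_down (fun=> 'M[R]_(upsz n N)) N (fun _ _ => True)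
  (fun i Y _ => AREd (A + cdn B i.+1 *m K i.+1) (rup C i)
              (- (L i.+1 *m rup V i.+1)) (rup V i) Y (L i) /\ psd Y)
  (fun=> 0) (Yh N).
- by [].
- move=> i y hi _.
  by have [x hx] := coupled_Y_exists hi hh hl; exists x.
have eK1 : K 1%N = Kh 1%N := Kfull1 Kh Kb.
have eLN : L N = Lh N := LfullN Lh Lb.
exists X, Y; split.
- split.
  + by rewrite eX1 eK1.
  + by move=> [//|[//|i]] hi; have [h _ _] := hX i.+1 hi; exact: h.
  + by rewrite eYN eLN.
  + by move=> i hi; have [h _] := hY i hi; exact: h.
- move=> i /andP [i1 iN]; split.
    case: i i1 iN => [//|[_ _|i _ iN]]; first by rewrite eX1.
    by have [_ h _] := hX i.+1 iN.
  move: iN; rewrite leq_eqVlt => /orP [/eqP ->|iN]; first by rewrite eYN.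
  by have [|_ h] := hY i; [rewrite i1 iN | exact: h].
- split.
  + split; first by rewrite eK1 -AhK1; exact: h1.
    by rewrite eLN -AhLN; exact: hNN.
  + move=> [h|[h|i hi]]; [by exfalso; move: h | by exfalso; move: h |].
    by have [_ _ h] := hX i.+1 hi; exact: h.
  + by move=> i hi; have [_ _ h] := hX i hi; rewrite addrAC; exact: h.
Qed.

End Solutions.

(** * Uniqueness: the blocks of an arbitrary coupled solution *)

Section Uniqueness.
Variables (R : realType) (N : nat) (n m p : nat -> nat) (q r : nat).
Variables (A : 'M[R]_(upsz n N, upsz n N)) (B : 'M[R]_(upsz n N, upsz m N))
  (C : 'M[R]_(upsz p N, upsz n N)) (F : 'M[R]_(q, upsz n N)) (H : 'M[R]_(q, upsz m N))
  (W : 'M[R]_(upsz n N, r)) (V : 'M[R]_(upsz p N, r)).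
Hypotheses (hN : (1 <= N)%N)
  (hA : lower_block_triangular A) (hB : lower_block_triangular B)
  (hC : lower_block_triangular C) (hyp1 : assumption1 A B C F H W V).
Variables (X : nat -> 'M[R]_(upsz n N)) (K : forall i, 'M[R]_(dnsz N m i, upsz n N))
  (Y : nat -> 'M[R]_(upsz n N)) (L : forall i, 'M[R]_(upsz n N, upsz p i)).
Hypotheses (hARE : coupled_AREs A B C F H W V X K Y L) (hpsd : coupled_psd X Y)
  (hends : stabilizing_ends A B C K L).

(** The blocks are cut like the unknowns of Assumption 2: [Xdn], [Kdn], [Yup], [Lup] will be
    compared with hatted quantities, [Xoff], [Koff], [Yoff], [Loff] with barred ones. *)
Definition Xdn i : 'M[R]_(dnsz N n i) := (Edn R N n i)^T *m X i *m Edn R N n i.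
Definition Kdn i : 'M[R]_(dnsz N m i, dnsz N n i) := K i *m Edn R N n i.
Definition Yup i : 'M[R]_(upsz n i) := (Eup R N n i)^T *m Y i *m Eup R N n i.
Definition Lup i : 'M[R]_(upsz n i, upsz p i) := (Eup R N n i)^T *m L i.
Definition Xoff i : 'M[R]_(upsz n i.-1, dnsz N n i) :=
  (Eup R N n i.-1)^T *m X i *m Edn R N n i.
Definition Koff i : 'M[R]_(dnsz N m i, upsz n i.-1) := K i *m Eup R N n i.-1.
Definition Yoff i : 'M[R]_(upsz n i, dnsz N n i.+1) :=
  (Eup R N n i)^T *m Y i *m Edn R N n i.+1.
Definition Loff i : 'M[R]_(dnsz N n i.+1, upsz p i) := (Edn R N n i.+1)^T *m L i.

Lemma Kfull_blocks i : (i < N)%N -> Kfull Kdn Koff i.+1 = K i.+1.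
Proof.
move=> hi; have [_ _ _ s1] := splits_Eup_Edn R n (ltnW hi).
by rewrite /Kfull /Kdn /Koff -!mulmxA -mulmxDr s1 mulmx1.
Qed.

Lemma Lfull_blocks i : (i <= N)%N -> Lfull Lup Loff i = L i.
Proof.
move=> hi; have [_ _ _ s1] := splits_Eup_Edn R n hi.
by rewrite /Lfull /Lup /Loff !mulmxA -mulmxDl s1 mul1mx.
Qed.

Lemma coupled_X_blocks j : (j.+1 < N)%N ->
  [/\ AREp (rdn (cdn A j.+2) j.+2) (rdn (cdn B j.+2) j.+2)
       (- (cdn H j.+1 *m Khb Kdn j.+1)) (cdn H j.+2) (Xdn j.+2) (Kdn j.+2),
      (Koff j.+2)^T *m rdn (cdn (Psi H) j.+2) j.+2 + Xoff j.+2 *m rdn (cdn B j.+2) j.+2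
        - (Defs.rowK Kdn Koff j.+1)^T *m rdn (cdn (Psi H) j.+2) j.+1 = 0 &
      (AhL A C Lup j.+1)^T *m Xoff j.+2 + Xoff j.+2 *m AhK A B Kdn j.+2
        + (AbL A C Loff j.+1)^T *m Xdn j.+2
        + (Defs.rowK Kdn Koff j.+1)^T *m
          (rdn (cdn (Psi H) j.+1) j.+1 *m Khb Kdn j.+1
           - rdn (cdn (Psi H) j.+2) j.+1 *m Kdn j.+2) = 0].
Proof.
move=> hj; have [_ hX _ _] := hARE; have := hX j.+2 hj.
have hj' := ltnW hj.
(* In recomposed form the gains fit the open-loop block formulas. *)
rewrite -[L _](Lfull_blocks hj') -[K j.+2.-1](Kfull_blocks hj').
move/(AREp_blocks (row_full_cdn hyp1 hj) (splits_Eup_Edn R n hj')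
  (open_loop_Eup A C Lup Loff hj) (open_loop_Edn hA hC Lup Loff hj) (mul_Edn hB hj')
  (weightH_Eup H Kdn Koff hj') (weightH_Edn H Kdn Koff hj')) => [b1 b2 b3].
have [e1 e2] := linear_system_XE A B C H Xdn Kdn Lup Xoff Koff Loff j.+1.
by split; [exact: b1 | rewrite e1; exact: b2 | rewrite e2; exact: b3].
Qed.

Lemma coupled_Y_blocks i : (1 <= i < N)%N ->
  [/\ AREd (rup (cup A i) i) (rup (cup C i) i) (- (Lhb Lup i.+1 *m rup V i.+1))
       (rup V i) (Yup i) (Lup i),
      rup (cup (Phi V) i) i *m (Loff i)^T + rup (cup C i) i *m Yoff i
        - rup (cup (Phi V) i.+1) i *m (colL Lup Loff i.+1)^T = 0 &
      AhL A C Lup i *m Yoff i + Yoff i *m (AhK A B Kdn i.+1)^T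
        + Yup i *m (AbK A B Koff i.+1)^T
        + (Lhb Lup i.+1 *m rup (cup (Phi V) i.+1) i.+1
           - Lup i *m rup (cup (Phi V) i.+1) i) *m (colL Lup Loff i.+1)^T = 0].
Proof.
move=> hi0; have [_ _ _ hY] := hARE; have := hY i hi0.
have /andP [i1 hi] := hi0; have hi' := ltnW hi.
have sY : (Y i)^T = Y i by have [|_ [h _]] := hpsd (i := i); [rewrite i1 hi' | exact: h].
rewrite -[L i.+1](Lfull_blocks hi) -[K i.+1](Kfull_blocks hi) => /AREdE.
move/(AREp_blocks (row_full_rup hyp1 hi')
  (splits_sym (splits_Eup_Edn R n hi')) (open_loop_tr_Edn A B Kdn Koff hi)
  (open_loop_tr_Eup hA hB Kdn Koff hi) (rupC_tr hC hi)
  (weightV_Edn V Lup Loff hi) (weightV_Eup V Lup Loff hi)) => [].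
have eL1 : (L i)^T *m Edn R N n i.+1 = (Loff i)^T by rewrite trmx_mulr.
have eL2 : (L i)^T *m Eup R N n i = (Lup i)^T by rewrite trmx_mulr.
have eY : (Edn R N n i.+1)^T *m Y i *m Eup R N n i = (Yoff i)^T.
  by rewrite /Yoff !trmx_mul trmxK sY mulmxA.
have sYu : (Yup i)^T = Yup i by rewrite /Yup !trmx_mul trmxK sY mulmxA.
rewrite eL1 eL2 eY -AhL_tr -/(Yup i) => b1 b2 b3.
have [e3 e4] := linear_system_YE A B C V Kdn Yup Lup Koff Yoff Loff i.
split; first by apply/AREdE; exact: b1.
- by rewrite e3 -[RHS]trmx0; congr (_^T); exact: b2.
- by rewrite e4 sYu -[RHS]trmx0; congr (_^T); exact: b3.
Qed.

Section Compare.
Variables (Xh : forall i, 'M[R]_(dnsz N n i)) (Kh : forall i, 'M[R]_(dnsz N m i, dnsz N n i))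
  (Yh : forall i, 'M[R]_(upsz n i)) (Lh : forall i, 'M[R]_(upsz n i, upsz p i)).
Hypothesis hh : hatted A B C F H W V Xh Kh Yh Lh.

(** Upward induction. At [i = 1] the solution is stabilizing by [hends]. Afterwards equality of the
    previous gains makes the trailing block solve the hatted equation, positive semidefiniteness
    makes it stabilizing, and stabilizing solutions are unique. *)
Lemma dn_eq_hatted i : (1 <= i <= N)%N -> Xdn i = Xh i /\ Kdn i = Kh i.
Proof.
have [[x1 xs] _ _ hur] := hh; have [[_ fH] _ _ _] := hyp1.
elim: i => [//|[_|j ih] hj].
  have [a1 _ _ _] := hARE; have [k1 _] := hends.
  have [|hk _] := hur 1%N; first by [].
  rewrite /AhK AhK1 in hk.
  have [eX eK] := AREp_stabilizing_unique fH x1 hk a1 k1.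
  rewrite /Xdn /Kdn Edn1 trmx1 mul1mx !mulmx1; exact: (conj eX eK).
have hj1 : (j.+1 < N)%N by []; have hj' := ltnW hj1.
have [eX eK] := ih hj'.
have [b1 _ _] := coupled_X_blocks hj1.
have e22 : (Edn R N n j.+2)^T *m Edn R N n j.+2 = 1%:M by apply: Edn_gram.
have pX : psd (Xdn j.+2) by apply: psd_congr; have [h _] := hpsd hj.
have ck : Khb Kdn j.+1 = Khb Kh j.+1 by rewrite /Khb eK.
rewrite ck in b1.
have [hk' _] := hur j.+1 hj'.
have [hk _] := hur j.+2 hj.
have hst : hurwitz (rdn (cdn A j.+2) j.+2 + rdn (cdn B j.+2) j.+2 *m Kdn j.+2).
  have eH : cdn H j.+2 = cdn H j.+1 *m idcols R (m j.+1) _ _.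
    by rewrite /cdn -mulmxA Edn_idcols.
  have [_ en _ _] := splits_dn R n hj'; have [_ em _ _] := splits_dn R m hj'.
  rewrite eH in b1.
  exact: (AREp_restrict_psd (row_full_cdn hyp1 hj') hk' en em
    (rdn_cdn_step hA hj1) (rdn_cdn_step hB hj1) b1 pX).
exact: (AREp_stabilizing_unique (row_full_cdn hyp1 hj1) (xs j.+1 hj1) hk b1 hst).
Qed.

(** Mirror image: the induction descends from [N], where the other half of [hends] enters. *)
Lemma up_eq_hatted i : (1 <= i <= N)%N -> Yup i = Yh i /\ Lup i = Lh i.
Proof.
have [_ [yN ys] _ hur] := hh.
move=> hi; have := hi; have -> : i = (N - (N - i))%N by lia.
have : (N - i < N)%N by lia.
move: (N - i)%N => d {i hi}; elim: d => [_ _|d ih hd hi].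
  rewrite subn0.
  have [_ _ a1 _] := hARE; have [_ k1] := hends.
  have [|_ hk] := hur N; first by rewrite hN leqnn.
  rewrite /AhL AhLN in hk.
  have [||eY eL] := AREp_stabilizing_unique (row_full_trV hyp1)
    (proj1 (AREdE _ _ _ _ _ _) yN) _ (proj1 (AREdE _ _ _ _ _ _) a1) _.
  - by rewrite -trmx_mul -trmxD; apply: hurwitz_tr; exact: hk.
  - by rewrite -trmx_mul -trmxD; apply: hurwitz_tr; exact: k1.
  rewrite /Yup /Lup EupN trmx1 !mul1mx mulmx1; split; first exact: eY.
  exact: (trmx_inj eL).
have ih' := ih (ltnW hd); move: ih' hi.
have -> : (N - d = (N - d.+1).+1)%N by lia.
have : (N - d.+1 < N)%N by lia.
move: (N - d.+1)%N => i {ih hd d} hi ih hi0.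
have [//|eY eL] := ih _.
have /andP [i1 _] := hi0; have hi1 : (1 <= i < N)%N by rewrite i1.
have hi' := ltnW hi.
have [b1 _ _] := coupled_Y_blocks hi1.
have pY : psd (Yup i) by apply: psd_congr; have [_ h] := hpsd hi0.
have ck : Lhb Lup i.+1 = Lhb Lh i.+1 by rewrite /Lhb eL.
rewrite ck in b1; move/AREdE: b1 => b1.
have [_ hk'] := hur i.+1 hi.
have [_ hk] := hur i hi0.
have hk1 : hurwitz ((rup (cup A i.+1) i.+1)^T + (rup (cup C i.+1) i.+1)^T *m (Lh i.+1)^T).
  by rewrite -AhL_tr; apply: hurwitz_tr; exact: hk'.
have hk2 : hurwitz ((rup (cup A i) i)^T + (rup (cup C i) i)^T *m (Lh i)^T).
  by rewrite -AhL_tr; apply: hurwitz_tr; exact: hk.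
have hst : hurwitz ((rup (cup A i) i)^T + (rup (cup C i) i)^T *m (Lup i)^T).
  have e1 : (- (Lhb Lh i.+1 *m rup V i.+1))^T =
      - ((rup V i.+1)^T *m ((Lh i.+1)^T *m idcols R 0 (upsz n i.+1) (upsz n i))).
    by rewrite trmxN (trmx_mul _ (rup V _)) /Lhb (trmx_mul _ (Lh _)) trmxK.
  have e2 : (rup V i)^T = (rup V i.+1)^T *m idcols R 0 (upsz p i.+1) (upsz p i).
    by rewrite /rup !trmx_mul !trmxK -mulmxA Eup_idcols0.
  have b2 := b1; rewrite e1 e2 in b2.
  have [en _ _ _] := splits_up R n i; have [em _ _ _] := splits_up R p i.
  exact: (AREp_restrict_psd (row_full_rup hyp1 hi) hk1 en em
    (rup_cup_step hA hi) (rup_cup_step hC hi) b2 pY).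
have [e1 e2] := AREp_stabilizing_unique (row_full_rup hyp1 hi')
  (proj1 (AREdE _ _ _ _ _ _) (ys i hi1)) hk2 b1 hst.
by split; [exact: e1 | exact: (trmx_inj e2)].
Qed.

(** Both comparisons with the hatted quantities are needed, since the equations mix [K] and [L];
    afterwards the uniqueness in Assumption 2 applies to any coupled solution. *)
Lemma off_linear_system : linear_system A B C H V Xh Kh Yh Lh Xoff Koff Yoff Loff.
Proof.
move=> [//|j] hj; have hj1 : (j.+1 < N)%N := hj.
have [_ b2 b3] := coupled_X_blocks hj1; have [_ c2 c3] := coupled_Y_blocks hj.
have hj' : (1 <= j.+1 <= N)%N by exact: ltnW.
have hj2 : (1 <= j.+2 <= N)%N by exact: hj1.
have [x1 k1] := dn_eq_hatted hj'; have [x2 k2] := dn_eq_hatted hj2.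
have [y1 l1] := up_eq_hatted hj'; have [y2 l2] := up_eq_hatted hj2.
move: b2 b3 c2 c3; rewrite /Defs.rowK /colL /AhL /AhK /Kha /Khb /Lha /Lhb.
by rewrite x2 k1 k2 y1 l1 l2 => b2 b3 c2 c3; split.
Qed.

End Compare.
End Uniqueness.

Section Final.
Variables (R : realType) (N : nat) (n m p : nat -> nat) (q r : nat).
Variables (A : 'M[R]_(upsz n N, upsz n N)) (B : 'M[R]_(upsz n N, upsz m N))
  (C : 'M[R]_(upsz p N, upsz n N)) (F : 'M[R]_(q, upsz n N)) (H : 'M[R]_(q, upsz m N))
  (W : 'M[R]_(upsz n N, r)) (V : 'M[R]_(upsz p N, r)).
Hypotheses (hN : (1 <= N)%N) (hyp1 : assumption1 A B C F H W V).

(** Closed loop matrices depend on the gains alone, so equal gains make both solutions stabilizing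
    for one and the same equation. *)
Lemma coupled_unique_of_gains (K K' : forall i, 'M[R]_(dnsz N m i, upsz n N))
    (L L' : forall i, 'M[R]_(upsz n N, upsz p i)) X X' Y Y' :
  coupled_AREs A B C F H W V X K Y L -> coupled_stabilizing A B C K L ->
  coupled_AREs A B C F H W V X' K' Y' L' ->
  (forall i, (1 <= i <= N)%N -> K' i = K i /\ L' i = L i) ->
  forall i, (1 <= i <= N)%N -> X' i = X i /\ Y' i = Y i.
Proof.
move=> [x1 xs yN ys] [[k1 lN] hX hY] [x1' xs' yN' ys'] eKL i hi.
have [[_ fH] _ _ _] := hyp1; have /andP [i1 iN] := hi.
have [eK eL] := eKL i hi; split.
  case: i i1 iN hi eK eL => [//|[_ _ hi eK _|j _ iN hi eK _]].
    rewrite eK in x1'; exact: (proj1 (AREp_stabilizing_unique fH x1 k1 x1' k1)).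
  have hj : (1 <= j.+1 <= N)%N by exact: ltnW.
  have [eK1 eL1] := eKL j.+1 hj.
  have b := xs' j.+2 iN; rewrite eK [L' _]eL1 [K' j.+2.-1]eK1 in b.
  exact: (proj1 (AREp_stabilizing_unique (row_full_cdn hyp1 iN)
    (xs j.+2 iN) (hX j.+2 iN) b (hX j.+2 iN))).
have tr (a b : nat) (A0 : 'M[R]_a) (C0 : 'M[R]_(b, a)) L0 :
    hurwitz (A0 + L0 *m C0) -> hurwitz (A0^T + C0^T *m L0^T).
  by move=> h; rewrite -trmx_mul -trmxD; apply: hurwitz_tr; exact: h.
move: iN; rewrite leq_eqVlt => /orP [/eqP e|iN].
  subst i; rewrite eL in yN'.
  exact: (proj1 (AREp_stabilizing_unique (row_full_trV hyp1)
    (proj1 (AREdE _ _ _ _ _ _) yN) (tr _ _ _ _ _ lN)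
    (proj1 (AREdE _ _ _ _ _ _) yN') (tr _ _ _ _ _ lN))).
have hi1 : (1 <= i < N)%N by rewrite i1.
have [eK1 eL1] := eKL i.+1 iN.
have b := ys' i hi1; rewrite eL eL1 eK1 in b.
exact: (proj1 (AREp_stabilizing_unique (row_full_rup hyp1 (ltnW iN))
  (proj1 (AREdE _ _ _ _ _ _) (ys i hi1)) (tr _ _ _ _ _ (hY i hi1))
  (proj1 (AREdE _ _ _ _ _ _) b) (tr _ _ _ _ _ (hY i hi1)))).
Qed.

End Final.

Theorem proposition2 (R : realType) (N : nat) (hN : (1 <= N)%N)
    (n m p : nat -> nat) (q r : nat)
    (A : 'M[R]_(upsz n N, upsz n N)) (B : 'M[R]_(upsz n N, upsz m N))
    (C : 'M[R]_(upsz p N, upsz n N))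
    (F : 'M[R]_(q, upsz n N)) (H : 'M[R]_(q, upsz m N))
    (W : 'M[R]_(upsz n N, r)) (V : 'M[R]_(upsz p N, r))
    (hA : lower_block_triangular A) (hB : lower_block_triangular B)
    (hC : lower_block_triangular C)
    (hyp1 : assumption1 A B C F H W V) (hyp2 : assumption2 A B C F H W V) :
  exists (X : nat -> 'M[R]_(upsz n N))
         (K : forall i, 'M[R]_(dnsz N m i, upsz n N))
         (Y : nat -> 'M[R]_(upsz n N))
         (L : forall i, 'M[R]_(upsz n N, upsz p i)),
    coupled_AREs A B C F H W V X K Y L /\
    coupled_psd X Y /\
    coupled_stabilizing A B C K L /\
    (forall X' K' Y' L',
       coupled_AREs A B C F H W V X' K' Y' L' ->
       coupled_psd X' Y' ->
       stabilizing_ends A B C K' L' ->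
       forall i, (1 <= i <= N)%N -> X' i = X i /\ Y' i = Y i).
Proof.
have [Xh [Kh [Yh [Lh hh]]]] := hatted_exists hN hA hB hC hyp1.
have [Xb [Kb [Yb [Lb [hl uniq]]]]] := hyp2 _ _ _ _ hh.
have [X [Y [h1 h2 h3]]] := coupled_exists hN hA hB hC hyp1 hh hl.
exists X, (Kfull Kh Kb), Y, (Lfull Lh Lb).
split; [exact: h1|split; [exact: h2|split; [exact: h3|]]].
move=> X' K' Y' L' a' p' e'.
have hl' := off_linear_system hN hA hB hC hyp1 a' p' e' hh.
have [uX uY] := uniq _ _ _ _ hl'.
apply: (coupled_unique_of_gains hyp1 h1 h3 a') => i hi.
have [_ eK] := dn_eq_hatted hA hB hC hyp1 a' p' e' hh hi.
have [_ eL] := up_eq_hatted hN hA hB hC hyp1 a' p' e' hh hi.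
have /andP [i1 iN] := hi; split.
  case: i i1 iN hi eK eL => [//|j _ hj _ eK _].
  rewrite -(Kfull_blocks K' hj) /Kfull eK; congr (_ + _).
  (* At index 1 the leading range is empty; from 2 on, Assumption 2 identifies the barred gains. *)
  case: j hj {eK} => [|j] hj.
    by rewrite (thinmx_eq0 (Eup R N n 1.-1) (upsz0 n)) trmx0 !mulmx0.
  by have [_ ->] := uX j.+2 hj.
rewrite -(Lfull_blocks L' iN) /Lfull eL; congr (_ + _).
move: iN; rewrite leq_eqVlt => /orP [/eqP e|iN].
  subst i; by rewrite (thinmx_eq0 (Edn R N n N.+1) (dnsz0 N n)) !mul0mx.
have hi1 : (1 <= i < N)%N by rewrite i1.
by have [_ ->] := uY i hi1.
Qed.
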